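(* Let $\omega$ be a closed $2$-form on $M=T^*\mathbb{R}^2$. A smooth real function $f$ on $M$ is a generating function of the Monge-Ampère equation $\Delta_\omega=0$ if and only if $f$ is pluriharmonic on the generalized complex manifold $(M,\exp(\omega-i\Omega))$, that is $$\partial\overline{\partial} f=0.$$
   Context: $M=T^*\mathbb{R}^2$ with coordinates $(q_1,q_2,p_1,p_2)$ and $\Omega=dq_1\wedge dp_1+dq_2\wedge dp_2$. For a $2$-form $\omega$, $\Delta_\omega(f)=(df)^*\omega$ is the Monge-Ampère operator. A function $f$ on $M$ is a generating function of $\Delta_\omega=0$ if there exist a $1$-form $\alpha$ and a function $g$ on $M$ (the conjugate function of $f$) with $d\alpha=f\omega+g\Omega$. Let $T=TM$. Elements of $(T\oplus T^* )\otimes\mathbb{C}$ act on complex forms by $\rho(X+\xi)\theta=\iota_X\theta+\xi\wedge\theta$. Put $\Theta=\omega-i\Omega$, $\Phi=\exp(\Theta)=1+\Theta+\frac12\Theta^2$, and $E=\{X+\xi:\rho(X+\xi)\Phi=0\}$; this is the $i$-eigenbundle of the generalized complex structure $\mathbb{J}$ associated with $(\omega,\Omega)$, and $\overline E=\{X-\iota_X\overline\Theta: X\in T\otimes\mathbb{C}\}$. Since $\overline E$ is isotropic for the natural pairing, $\rho$ extends to $\Lambda^\bullet\overline E$ (via the Clifford algebra). Set $U_k=\rho(\Lambda^{2-k}\overline E)(\Phi)$ for $k=-2,\dots,2$; then $\Lambda^*(T^* )\otimes\mathbb{C}=U_{-2}\oplus U_{-1}\oplus U_0\oplus U_1\oplus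 U_2$. Let $\mathcal{U}_k$ be the smooth sections of $U_k$ and $\pi_k:\Omega^*(M)\otimes\mathbb{C}\to\mathcal{U}_k$ the projection (with $\pi_{\pm 3}=0$). On $\mathcal{U}_k$ define $\overline\partial=\pi_{k+1}\circ d$ and $\partial=\pi_{k-1}\circ d$, and extend $\partial,\overline\partial$ linearly to all of $\Omega^*(M)\otimes\mathbb{C}$. A function $f$ is regarded as an element of $\Omega^0(M)\subset\Omega^*(M)\otimes\mathbb{C}$, which in general has components in $\mathcal{U}_{-2}$, $\mathcal{U}_0$, $\mathcal{U}_2$. *)

(* Defs.v *)
From HB Require Import structures.
From mathcomp Require Import all_boot all_order all_algebra.
From mathcomp Require Import complex.
From mathcomp Require Import all_classical all_reals all_analysis.

Set Implicit Arguments.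
Unset Strict Implicit.
Unset Printing Implicit Defensive.

Import Order.TTheory GRing.Theory Num.Theory.
Import numFieldNormedType.Exports.

Local Open Scope ring_scope.

(* An element of the exterior algebra of the dual of F^n is given by its
   coefficients on the basis e_S = e_{s_1} /\ ... /\ e_{s_k}, for
   S = {s_1 < ... < s_k}; the degree-k part is spanned by the e_S, #|S| = k. *)
Notation exterior F n := {ffun {set 'I_n} -> F^o}.

Section Exterior.
Variables (F : fieldType) (n : nat).
Implicit Types (A S : {set 'I_n}) (a b : exterior F n).
Implicit Types (X xi : 'rV[F]_n) (e : 'rV[F]_n * 'rV[F]_n).

(* e_A /\ e_B = shuffle_sign A B * e_(A :|: B) for disjoint A and B *)
Definition shuffle_sign (A B : {set 'I_n}) : F :=
  (-1) ^+ #|[set ij : 'I_n * 'I_n |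
              [&& ij.1 \in A, ij.2 \in B & (ij.2 < ij.1)%N]]|.

Definition ext_basis S : exterior F n := [ffun A : {set 'I_n} => (A == S)%:R].

Definition wedge a b : exterior F n :=
  [ffun S : {set 'I_n} => \sum_(A : {set 'I_n} | A \subset S)
               shuffle_sign A (S :\: A) * a A * b (S :\: A)].

Definition interior_product X a : exterior F n :=
  [ffun S : {set 'I_n} => \sum_(i | i \notin S) shuffle_sign [set i] S * X 0 i * a (i |: S)].

Definition covector xi : exterior F n :=
  \sum_i xi 0 i *: ext_basis [set i].

Definition homogeneous (k : nat) a := forall S, #|S| != k -> a S = 0.

(* rho (X, xi) is the action of the generalized vector X + xi. *)
Definition rho e a : exterior F n := interior_product e.1 a + wedge (covector e.2) a.

Lemma rho_is_linear e : linear (rho e).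
Proof.
move=> c a b; rewrite /rho scalerDr addrACA; congr (_ + _);
  apply/ffunP => S; rewrite !ffunE scaler_sumr -big_split /=;
  apply: eq_bigr => i _; rewrite !ffunE mulrDr; congr (_ + _);
  by rewrite /GRing.scale /= mulrCA.
Qed.

HB.instance Definition _ e :=
  GRing.isLinear.Build F (exterior F n) (exterior F n) *:%R (rho e)
    (rho_is_linear e).

Definition rho_on a e : exterior F n := rho e a.

Lemma rho_on_is_linear a : linear (rho_on a).
Proof.
move=> c e e'; rewrite /rho_on /rho scalerDr addrACA; congr (_ + _).
  apply/ffunP => S; rewrite !ffunE scaler_sumr -big_split /=.
  apply: eq_bigr => i _; rewrite !mxE mulrDr mulrDl; congr (_ + _).
  by rewrite /GRing.scale /= mulrCA !mulrA.
have -> : covector (c *: e + e').2 = c *: covector e.2 + covector e'.2.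
  rewrite /covector scaler_sumr -big_split; apply: eq_bigr => i _ /=.
  by rewrite !mxE scalerDl scalerA.
move: (covector e.2) (covector e'.2) => u v.
apply/ffunP => S; rewrite !ffunE scaler_sumr -big_split /=.
apply: eq_bigr => A _; rewrite !ffunE mulrDr mulrDl; congr (_ + _).
by rewrite /GRing.scale /= mulrCA !mulrA.
Qed.

HB.instance Definition _ a :=
  GRing.isLinear.Build F ('rV[F]_n * 'rV[F]_n)%type (exterior F n) *:%R
    (rho_on a) (rho_on_is_linear a).

(* The span of the rho e_1 (... (rho e_k a)) with e_1, ..., e_k in W; when W is
   isotropic this is the image of the k-th exterior power of W acting on a. *)
Fixpoint cliffordv (W : {vspace 'rV[F]_n * 'rV[F]_n}) (k : nat) a
    : {vspace exterior F n} :=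
  if k is k'.+1 then
    (\sum_(e <- vbasis W) (linfun (rho e) @: cliffordv W k' a))%VS
  else <[a]>%VS.

End Exterior.

Section Fields.
Variables (R : realType) (n : nat).
Local Notation M := 'rV[R]_n.+1.

Definition partial (i : 'I_n.+1) (h : M -> R) : M -> R :=
  fun x => 'D_(delta_mx 0 i) h x.

Definition smooth (h : M -> R) : Prop :=
  forall s : seq 'I_n.+1,
    continuous (foldr partial h s) /\
    forall (i : 'I_n.+1) (x : M), derivable (foldr partial h s) x (delta_mx 0 i).

Definition cpartial (i : 'I_n.+1) (h : M -> R[i]) : M -> R[i] :=
  fun x => (partial i (fun y => complex.Re (h y)) x
            +i* partial i (fun y => complex.Im (h y)) x)%C.

Definition is_form (k : nat) (t : M -> exterior R n.+1) : Prop :=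
  (forall x, homogeneous k (t x)) /\ (forall S, smooth (fun x => t x S)).

(* d t = \sum_i dx_i /\ D_i t, the partial derivatives D being coefficientwise *)
Definition ext_deriv (F : fieldType) (D : 'I_n.+1 -> (M -> F) -> M -> F)
    (t : M -> exterior F n.+1) : M -> exterior F n.+1 :=
  fun x => \sum_i wedge (ext_basis F [set i])
                        [ffun S : {set 'I_n.+1} => D i (fun y => t y S) x].

Definition extd (t : M -> exterior R n.+1) := ext_deriv partial t.
Definition extdC (t : M -> exterior R[i] n.+1) := ext_deriv cpartial t.

Definition complexify (a : exterior R n.+1) : exterior R[i] n.+1 :=
  [ffun S : {set 'I_n.+1} => ((a S : R)%:C)%C].

End Fields.

(* The coordinates (q1, q2, p1, p2) of T^*R^2 are numbered 0, 1, 2, 3. *)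
Definition iq1 : 'I_4 := @Ordinal 4 0 isT.
Definition iq2 : 'I_4 := @Ordinal 4 1 isT.
Definition ip1 : 'I_4 := @Ordinal 4 2 isT.
Definition ip2 : 'I_4 := @Ordinal 4 3 isT.

Section MongeAmpere.
Variable R : realType.
Local Notation M := 'rV[R]_4.
Local Notation C := R[i].

Definition Omega : exterior R 4 :=
  wedge (ext_basis R [set iq1]) (ext_basis R [set ip1]) +
  wedge (ext_basis R [set iq2]) (ext_basis R [set ip2]).

Variable omega : M -> exterior R 4.

Definition generating_function (f : M -> R) : Prop :=
  exists (alpha : M -> exterior R 4) (g : M -> R),
    [/\ is_form 1 alpha, smooth g &
        forall x, extd alpha x = f x *: omega x + g x *: Omega].

Definition Theta (x : M) : exterior C 4 :=
  complexify (omega x) - 'i%C *: complexify Omega.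

Definition Phi (x : M) : exterior C 4 :=
  ext_basis C finset.set0 + Theta x + 2^-1 *: wedge (Theta x) (Theta x).

Definition E (x : M) : {vspace 'rV[C]_4 * 'rV[C]_4} :=
  lker (linfun (rho_on (Phi x))).

Definition conj_gvect (e : 'rV[C]_4 * 'rV[C]_4) : 'rV[C]_4 * 'rV[C]_4 :=
  (map_mx conjc e.1, map_mx conjc e.2).

(* Conjugation is only semilinear, so the conjugate of E is given as the span of
   the conjugates of a basis. *)
Definition Ebar (x : M) : {vspace 'rV[C]_4 * 'rV[C]_4} :=
  <<[seq conj_gvect e | e <- vbasis (E x)]>>%VS.

Definition U (k : int) (x : M) : {vspace exterior C 4} :=
  if (`|k| <= 2)%N then cliffordv (Ebar x) `|2 - k|%N (Phi x) else 0%VS.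

(* the weights -2, -1, 0, 1, 2 *)
Definition weight (j : 'I_5) : int := j%:Z - 2.

(* The projection on U_k along the sum of the other U_j, applied pointwise.
   It is zero for k = -3 and k = 3. *)
Definition pi_ (k : int) (t : M -> exterior C 4) : M -> exterior C 4 :=
  fun x => daddv_pi (U k x) (\sum_(j | weight j != k) U (weight j) x)%VS (t x).

(* delbar and del are defined on arbitrary fields of forms, the derivatives being
   total functions; they are meant for smooth t, for which each pi_ k t is
   smooth. *)
Definition delbar (t : M -> exterior C 4) : M -> exterior C 4 :=
  fun x => \sum_j pi_ (weight j + 1) (extdC (pi_ (weight j) t)) x.

Definition del (t : M -> exterior C 4) : M -> exterior C 4 :=
  fun x => \sum_j pi_ (weight j - 1) (extdC (pi_ (weight j) t)) x.

Definition function_form (f : M -> R) : M -> exterior C 4 :=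
  fun x => complexify (f x *: ext_basis R finset.set0).

Definition pluriharmonic (f : M -> R) : Prop :=
  forall x, del (delbar (function_form f)) x = 0.

End MongeAmpere.

(* Main.v *)
Require Import Defs.
From HB Require Import structures.
From mathcomp Require Import all_boot all_order all_algebra.
From mathcomp Require Import boolp.
From mathcomp Require Import ring zify.

Set Implicit Arguments.
Unset Strict Implicit.
Unset Printing Implicit Defensive.

Import Order.TTheory GRing.Theory Num.Theory.

Local Open Scope ring_scope.

(** Put Theta = omega - i Omega. This complex 2-form is closed, and
    Theta - conj Theta = - 2 i Omega does not depend on the point; everything
    follows from these two facts.

    An element of Ebar is e = X - i_X (conj Theta), and it acts by
      rho e (exp Theta /\ a) = exp Theta /\ (i_X a - 2 i (i_X Omega) /\ a),
    so that the wedge product by exp Theta makes the decomposition into the U_k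
    constant. Let L be the contraction with the Poisson bivector inverse to
    Omega. The constant operator exp (c L), with c = - i / 2, conjugates the
    exterior multiplications by covectors to the operators
    i_X - 2 i (i_X Omega) /\ _ (rho_frame). Hence the frame
    exp Theta /\ exp (c L) _ carries the forms of degree 2 - k onto U_k, and the
    projections pi_k become the projections on degrees (pi_weight). As Theta is
    closed, d commutes with exp Theta; and d exp (c L) = exp (c L) (d - c [L, d]),
    where d raises degrees by one and [L, d] lowers them by one. So in the frame
    del is d and delbar is - c [L, d] (del_frame, delbar_frame).

    A function f is the image of exp (- c L) (exp (- Theta) f) under the frame.
    Since [L, d] commutes with L and has square zero, del delbar f is an
    invertible operator applied to d [L, d] (exp (- Theta) f), that is, to
    d L d (exp (- Theta) f). Now d (exp (- Theta) f) = df - Theta /\ df, the next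
    term having degree 5; L kills df; and L (Omega /\ df) = df is closed. What
    remains is the real 2-form d L (omega /\ df) (d_dL_function, del_delbarE).

    On the other side, L is the inverse of Omega /\ _ between 1-forms and
    3-forms (contr_symp1, contr_inj3), and d (f omega + g Omega) =
    omega /\ df + Omega /\ dg. By the Poincare lemma for 2-forms, f is a
    generating function if and only if L (omega /\ df) = - dg for some g; by the
    Poincare lemma for 1-forms, this holds if and only if L (omega /\ df) is
    closed (generating_functionP).

    The functions at hand are smooth in the sense of iterated partial
    derivatives. The symmetry of second derivatives (derive_comm) and the chain
    rule along lines (smooth_is_derive) come from the mean value theorem, and the
    Poincare lemma (poincare) from the homotopy operator of a star-shaped domain,
    whose coefficients are means over rays. *)

(** * Exterior algebra *)

Section ExteriorOperators.
Variables (F : fieldType) (n : nat).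
Implicit Types (A B S T : {set 'I_n}) (a b c : exterior F n) (i j : 'I_n).

Local Notation eps i := (wedge (ext_basis F [set i])).
Local Notation iota i := (interior_product (delta_mx 0 i)).
Local Notation sg := (@shuffle_sign F n).

Lemma ext_addE a b S : (a + b) S = a S + b S. Proof. by rewrite ffunE. Qed.

Lemma ext_oppE a S : (- a) S = - a S. Proof. by rewrite ffunE. Qed.

Lemma ext_zeroE S : (0 : exterior F n) S = 0. Proof. by rewrite ffunE. Qed.

Lemma ext_scaleE k a S : (k *: a) S = k * a S. Proof. by rewrite ffunE. Qed.

Lemma wedge_is_linear a : linear (wedge a).
Proof.
move=> k b c; apply/ffunP => S; rewrite !ffunE scaler_sumr -big_split /=.
apply: eq_bigr => A _; rewrite !ffunE mulrDr; congr (_ + _).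
by rewrite /GRing.scale /= mulrCA.
Qed.

HB.instance Definition _ a :=
  GRing.isLinear.Build F (exterior F n) (exterior F n) *:%R (wedge a)
    (wedge_is_linear a).

Lemma interior_product_is_linear (X : 'rV[F]_n) : linear (interior_product X).
Proof.
move=> k b c; apply/ffunP => S; rewrite !ffunE scaler_sumr -big_split /=.
apply: eq_bigr => A _; rewrite !ffunE mulrDr; congr (_ + _).
by rewrite /GRing.scale /= mulrCA.
Qed.

HB.instance Definition _ (X : 'rV[F]_n) :=
  GRing.isLinear.Build F (exterior F n) (exterior F n) *:%R
    (interior_product X) (interior_product_is_linear X).

Lemma wedge_linearl k a b c : wedge (k *: a + b) c = k *: wedge a c + wedge b c.
Proof.
apply/ffunP => S; rewrite !ffunE scaler_sumr -big_split /=.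
apply: eq_bigr => A _; rewrite !ffunE mulrDr mulrDl; congr (_ + _).
by rewrite /GRing.scale /= mulrCA !mulrA.
Qed.

Lemma wedgeDl a b c : wedge (a + b) c = wedge a c + wedge b c.
Proof. by have := wedge_linearl 1 a b c; rewrite !scale1r. Qed.

Lemma wedge0l c : wedge 0 c = 0.
Proof. by apply/eqP; have := wedgeDl 0 0 c; rewrite addr0 -[LHS]addr0 => /addrI <-. Qed.

Lemma wedgeZl k a c : wedge (k *: a) c = k *: wedge a c.
Proof. by have := wedge_linearl k a 0 c; rewrite wedge0l !addr0. Qed.

Lemma wedgeNl a c : wedge (- a) c = - wedge a c.
Proof. by rewrite -scaleN1r wedgeZl scaleN1r. Qed.

Lemma wedgeDr a b c : wedge a (b + c) = wedge a b + wedge a c.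
Proof. exact: linearD. Qed.

Lemma wedgeZr k a b : wedge a (k *: b) = k *: wedge a b.
Proof. exact: linearZ. Qed.

Lemma wedgeNr a b : wedge a (- b) = - wedge a b.
Proof. exact: linearN. Qed.

Lemma wedge0r a : wedge a 0 = 0.
Proof. exact: linear0. Qed.

Lemma interior_productD (X : 'rV[F]_n) a b :
  interior_product X (a + b) = interior_product X a + interior_product X b.
Proof. exact: linearD. Qed.

Lemma interior_productZ (X : 'rV[F]_n) k a :
  interior_product X (k *: a) = k *: interior_product X a.
Proof. exact: linearZ. Qed.

Lemma interior_productN (X : 'rV[F]_n) a :
  interior_product X (- a) = - interior_product X a.
Proof. exact: linearN. Qed.

Lemma interior_product0 (X : 'rV[F]_n) : interior_product X 0 = 0.
Proof. exact: linear0. Qed.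

Lemma wedge_suml (I : Type) (r : seq I) (P : pred I) (f : I -> exterior F n) c :
  wedge (\sum_(i <- r | P i) f i) c = \sum_(i <- r | P i) wedge (f i) c.
Proof.
by elim/big_rec2: _ => [|i x y _ <-]; [rewrite wedge0l|rewrite wedgeDl].
Qed.

Lemma shuffle_signUl A B T : [disjoint A & B] -> sg (A :|: B) T = sg A T * sg B T.
Proof.
move=> dAB; rewrite /shuffle_sign -exprD -cardsUI.
set X := [set _ | _]; set Y := [set _ | _]; set Z := [set _ | _].
have -> : Y :&: Z = set0.
  apply/setP => -[x y]; rewrite !inE /=.
  by case: (boolP (x \in A)) => //= xA; rewrite (disjointFr dAB xA) andbF.
rewrite cards0 addn0; congr (_ ^+ #|pred_of_set _|).
by apply/setP => -[x y]; rewrite !inE /= andb_orl.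
Qed.

Lemma shuffle_signUr A B T : [disjoint B & T] -> sg A (B :|: T) = sg A B * sg A T.
Proof.
move=> dBT; rewrite /shuffle_sign -exprD -cardsUI.
set X := [set _ | _]; set Y := [set _ | _]; set Z := [set _ | _].
have -> : Y :&: Z = set0.
  apply/setP => -[x y]; rewrite !inE /=.
  by case: (boolP (y \in B)) => yB; rewrite ?(disjointFr dBT yB) ?andbF.
rewrite cards0 addn0; congr (_ ^+ #|pred_of_set _|).
by apply/setP => -[x y]; rewrite !inE /= andb_orl andb_orr.
Qed.

Lemma shuffle_sign0l T : sg set0 T = 1.
Proof.
rewrite /shuffle_sign (_ : [set _ | _] = set0) ?cards0 //.
by apply/setP => -[x y]; rewrite !inE.
Qed.

Lemma shuffle_sign1 i j : sg [set i] [set j] = (-1) ^+ (j < i)%N.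
Proof.
rewrite /shuffle_sign; case: ltnP => ij.
  rewrite (_ : [set _ | _] = [set (i, j)]) ?cards1 //.
  apply/setP => -[x y]; rewrite !inE xpair_eqE /=.
  by case: eqP => //= ->; case: eqP => //= ->.
rewrite (_ : [set _ | _] = set0) ?cards0 //.
apply/setP => -[x y]; rewrite !inE /=.
by case: eqP => //= ->; case: eqP => //= ->; rewrite ltnNge ij.
Qed.

Lemma shuffle_sign_sqr A B : sg A B * sg A B = 1.
Proof. by rewrite -expr2 sqrr_sign. Qed.

Lemma shuffle_sign_setU1 i j S : j \notin S ->
  sg [set i] (j |: S) = (-1) ^+ (j < i)%N * sg [set i] S.
Proof. by move=> jS; rewrite shuffle_signUr ?disjoints1 // shuffle_sign1. Qed.

Lemma eps_coef i a S :
  (eps i a) S = if i \in S then sg [set i] (S :\ i) * a (S :\ i) else 0.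
Proof.
rewrite ffunE; case: ifPn => iS.
  rewrite (bigD1 [set i]) ?sub1set //= ffunE eqxx mulr1 big1 ?addr0 // => A.
  by case/andP => _ /negPf Ai; rewrite ffunE Ai mulr0 mul0r.
rewrite big1 // => A AS; rewrite ffunE; case: eqP => [Ai|_]; last by rewrite mulr0 mul0r.
by move: AS; rewrite Ai sub1set (negPf iS).
Qed.

Lemma iota_coef i a S :
  (iota i a) S = if i \notin S then sg [set i] S * a (i |: S) else 0.
Proof.
rewrite ffunE; case: ifPn => iS.
  rewrite (bigD1 i) //= mxE !eqxx mulr1 big1 ?addr0 // => j.
  by case/andP => _ /negPf ji; rewrite mxE ji andbF mulr0 mul0r.
rewrite big1 // => j jS; rewrite mxE; case: (j =P i) => [ji|_]; last by rewrite andbF mulr0 mul0r.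
by rewrite -ji jS in iS.
Qed.

Lemma neq_ltn_sign i j : i != j ->
  (-1) ^+ (j < i)%N = - (-1) ^+ (i < j)%N :> F.
Proof.
by rewrite -(inj_eq val_inj) neq_ltn; case: ltngtP => //= _ _; rewrite ?expr0 ?expr1 ?opprK.
Qed.

Lemma eps_eps0 i a : eps i (eps i a) = 0.
Proof.
by apply/ffunP => S; rewrite !eps_coef ext_zeroE setD11 mulr0 if_same.
Qed.

Lemma iota_iota0 i a : iota i (iota i a) = 0.
Proof.
by apply/ffunP => S; rewrite !iota_coef ext_zeroE setU11 mulr0 if_same.
Qed.

Lemma setD1_comm S i j : S :\ i :\ j = S :\ j :\ i.
Proof. by rewrite !setDDl setUC. Qed.

Lemma eps_anticomm i j a : eps i (eps j a) = - eps j (eps i a).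
Proof.
have [->|ij] := eqVneq i j; first by rewrite !eps_eps0 oppr0.
apply/ffunP => S; rewrite ext_oppE !eps_coef !in_setD1 ij eq_sym ij /=.
case: (boolP (i \in S)) => iS; case: (boolP (j \in S)) => jS; rewrite /= ?mulr0 ?oppr0 //.
have Ei : S :\ i = j |: (S :\ i :\ j) by rewrite setD1K // !inE eq_sym ij.
have Ej : S :\ j = i |: (S :\ i :\ j) by rewrite setD1_comm setD1K // !inE ij.
have Hi : sg [set i] (S :\ i) = (-1) ^+ (j < i)%N * sg [set i] (S :\ i :\ j).
  by rewrite [in LHS]Ei shuffle_sign_setU1 ?inE ?eqxx.
have Hj : sg [set j] (S :\ j) = (-1) ^+ (i < j)%N * sg [set j] (S :\ i :\ j).
  by rewrite [in LHS]Ej shuffle_sign_setU1 ?inE ?eqxx ?andbF.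
rewrite (setD1_comm S j i) Hi Hj neq_ltn_sign //.
by move: ((-1) ^+ _) (a _) => *; ring.
Qed.

Lemma iota_anticomm i j a : iota i (iota j a) = - iota j (iota i a).
Proof.
have [->|ij] := eqVneq i j; first by rewrite !iota_iota0 oppr0.
apply/ffunP => S; rewrite ext_oppE !iota_coef !in_setU1 (eq_sym j) (negPf ij) /=.
case: (boolP (i \in S)) => iS; case: (boolP (j \in S)) => jS; rewrite /= ?mulr0 ?oppr0 //.
rewrite !shuffle_sign_setU1 // setUCA neq_ltn_sign 1?eq_sym //.
by move: ((-1) ^+ _) (a _) => *; ring.
Qed.

(** With eps_anticomm and iota_anticomm these are the canonical anticommutation
    relations. The identities between forms below are deduced from them and from
    exterior_ind, without further computation of shuffle signs. *)
Lemma iota_eps i j a :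
  iota i (eps j a) = (i == j)%:R *: a - eps j (iota i a).
Proof.
apply/ffunP => S; rewrite ext_addE ext_scaleE ext_oppE !eps_coef !iota_coef.
have [<-|ij] := eqVneq i j.
  case: ifPn => iS; first by rewrite (negPf iS) eps_coef setU11 /= setU1K //
    mulrA shuffle_sign_sqr mul1r subr0.
  rewrite negbK in iS; rewrite iS in_setD1 eqxx /= setD1K // mulrA shuffle_sign_sqr mul1r.
  by rewrite ?mul1r subrr.
rewrite mul0r sub0r !eps_coef in_setU1 in_setD1 (eq_sym j) (negPf ij) /=.
case: (boolP (i \in S)) => iS; case: (boolP (j \in S)) => jS; rewrite /= ?mulr0 ?oppr0 //.
have Ei : (i |: S) :\ j = i |: (S :\ j).
  by apply/setP => k; rewrite !inE; case: eqP => //= ->; rewrite eq_sym (negPf ij).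
have Hi : sg [set i] S = (-1) ^+ (j < i)%N * sg [set i] (S :\ j).
  by rewrite -[in LHS](setD1K jS) shuffle_sign_setU1 ?inE ?eqxx.
have Hj : sg [set j] (i |: S :\ j) = (-1) ^+ (i < j)%N * sg [set j] (S :\ j).
  by rewrite shuffle_sign_setU1 // !inE (negPf iS) andbF.
rewrite Ei Hi Hj neq_ltn_sign //.
have := sqrr_sign F (i < j)%N.
move: ((-1) ^+ (i < j)%N) (a _) (sg _ _) (sg _ _) => s x u v ss.
by rewrite -[RHS]mulr1 -ss; ring.
Qed.

End ExteriorOperators.

Section ExteriorAlgebra.
Variables (F : fieldType) (n : nat).
Implicit Types (A B S T : {set 'I_n}) (a b c : exterior F n) (i j : 'I_n).
Implicit Types (X xi : 'rV[F]_n) (k l m : nat).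

Local Notation one := (ext_basis F set0 : exterior F n).
Local Notation eps i := (wedge (ext_basis F [set i])).
Local Notation iota i := (interior_product (delta_mx 0 i)).
Local Notation sg := (@shuffle_sign F n).

Lemma exterior_basis a : a = \sum_S a S *: ext_basis F S.
Proof.
apply/ffunP => T; rewrite sum_ffunE (bigD1 T) //= big1 => [|S ST].
  by rewrite ext_scaleE ffunE eqxx mulr1 addr0.
by rewrite ext_scaleE ffunE eq_sym (negPf ST) mulr0.
Qed.

Lemma eps_basis i S : i \notin S ->
  eps i (ext_basis F S) = sg [set i] S *: ext_basis F (i |: S).
Proof.
move=> iS; apply/ffunP => T; rewrite eps_coef ext_scaleE !ffunE.
have [->|TS] := eqVneq T (i |: S); first by rewrite setU11 setU1K // eqxx.
case: ifP => iT; last by rewrite mulr0.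
case: eqP => [E|_]; last by rewrite !mulr0.
by rewrite -E setD1K ?eqxx in TS.
Qed.

(** Up to sign, e_S is a product of factors e_i. Associativity and the
    commutation rules of the wedge product reduce in this way to the case of a
    single factor. *)
Lemma exterior_ind (P : exterior F n -> Prop) :
    P one -> (forall i a, P a -> P (eps i a)) ->
    P 0 -> (forall (c : F) a b, P a -> P b -> P (c *: a + b)) ->
  forall a, P a.
Proof.
move=> P1 Peps P0 Plin a; rewrite (exterior_basis a).
apply: (big_ind P) => // [b c Pb Pc|S _]; first by rewrite -[b]scale1r; exact: Plin.
rewrite -[_ *: _]addr0; apply: (Plin) => //.
have [m] := ubnP #|S|; elim: m S => // m IH S.
have [->|[i iS]] := set_0Vmem S; first by [].
rewrite (cardsD1 i) iS ltnS => /IH/(Peps i).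
rewrite eps_basis ?setD11 // setD1K // => /(Plin (sg [set i] (S :\ i)) _ _)/(_ P0).
by rewrite addr0 scalerA shuffle_sign_sqr scale1r.
Qed.

Lemma wedge1l a : wedge one a = a.
Proof.
apply/ffunP => S; rewrite ffunE (bigD1 set0) ?sub0set //= big1 => [|A /andP[_ /negPf A0]].
  by rewrite ffunE eqxx shuffle_sign0l setD0 !mul1r addr0.
by rewrite ffunE A0 mulr0 mul0r.
Qed.

Lemma wedge1r a : wedge a one = a.
Proof.
apply/ffunP => S; rewrite ffunE (bigD1 S) ?subxx //= big1 => [|A /andP[AS NA]].
  rewrite setDv ffunE eqxx mulr1 addr0 /shuffle_sign (_ : [set _ | _] = set0).
    by rewrite cards0 mul1r.
  by apply/setP => -[x y]; rewrite !inE andbF.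
rewrite ffunE setD_eq0; case: (boolP (S \subset A)) => SA; last by rewrite mulr0.
by rewrite eqEsubset AS SA in NA.
Qed.

(** Among the terms of the left-hand side only those with i in A survive; they
    correspond to the terms A minus i of the right-hand side, and the signs agree
    because shuffle_sign is multiplicative in both arguments. *)
Lemma wedge_epsl i a b : wedge (eps i a) b = eps i (wedge a b).
Proof.
apply/ffunP => S; rewrite eps_coef ffunE; case: ifPn => iS; last first.
  rewrite big1 // => A AS; rewrite eps_coef; case: ifPn => iA; last by rewrite mulr0 mul0r.
  by rewrite (subsetP AS _ iA) in iS.
rewrite [in RHS]ffunE mulr_sumr (bigID (fun A => i \in A)) /= [X in _ + X]big1 ?addr0; last first.
  by move=> A /andP[_ iA]; rewrite eps_coef (negPf iA) mulr0 mul0r.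
rewrite (reindex_onto (fun A => i |: A) (fun A => A :\ i)) /=; last first.
  by move=> A /andP[_ iA]; rewrite setD1K.
apply: eq_big => [A|A /andP[/andP[AS _] /eqP AE]].
  rewrite setU11 andbT subUset sub1set iS /= subsetD1.
  apply: andb_id2l => AS; apply/eqP/idP => [<-|iA]; [by rewrite setD11|exact: setU1K].
have iA : i \notin A by rewrite -AE setD11.
have {}AS : A \subset S :\ i.
  by move: AS; rewrite subUset subsetD1 iA => /andP[_ ->].
rewrite eps_coef setU11 setU1K //.
have E : S :\: (i |: A) = S :\ i :\: A by rewrite setDDl.
rewrite E; set T := S :\ i :\: A.
have ET : S :\ i = A :|: T by rewrite -[LHS](setID _ A) (setIidPr AS).
have dAT : [disjoint A & T].
  by rewrite -setI_eq0 /T [_ :\: A]setDE setICA setICr setI0.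
rewrite [in RHS]ET shuffle_signUl ?disjoints1 // shuffle_signUr //.
by move: (a _) (b _) (sg A T) (sg _ T) => *; ring.
Qed.

Lemma wedgeA a b c : wedge (wedge a b) c = wedge a (wedge b c).
Proof.
elim/exterior_ind: a => [|i a IH||k a a' Ha Ha'].
- by rewrite !wedge1l.
- by rewrite !wedge_epsl IH.
- by rewrite !wedge0l.
- by rewrite !(wedgeDl, wedgeZl) Ha Ha'.
Qed.

Lemma interior_productE X a : interior_product X a = \sum_i X 0 i *: iota i a.
Proof.
apply/ffunP => S; rewrite sum_ffunE ffunE big_mkcond; apply: eq_bigr => i _.
by rewrite ext_scaleE iota_coef; case: ifP => _; [ring|rewrite mulr0].
Qed.

(** The grade involution gives the sign which an odd operator picks up when it
    moves past a form (iota_wedge, wedge_epsr). *)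
Definition gradeinv a : exterior F n := [ffun S : {set 'I_n} => (-1) ^+ #|S| * a S].

Lemma gradeinv_lin (k : F) a b : gradeinv (k *: a + b) = k *: gradeinv a + gradeinv b.
Proof.
apply/ffunP => S; rewrite !ffunE mulrDr; congr (_ + _).
by rewrite /GRing.scale /= mulrCA.
Qed.

Lemma gradeinv0 : gradeinv 0 = 0.
Proof. by apply/ffunP => S; rewrite !ffunE mulr0. Qed.

Lemma gradeinv_one : gradeinv one = one.
Proof.
by apply/ffunP => S; rewrite !ffunE; case: eqP => [->|_]; rewrite ?mulr0 ?cards0 ?mul1r.
Qed.

Lemma gradeinv_eps i a : gradeinv (eps i a) = - eps i (gradeinv a).
Proof.
apply/ffunP => S; rewrite ext_oppE ffunE !eps_coef; case: ifP => iS; last by rewrite mulr0 oppr0.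
by rewrite ffunE (cardsD1 i) iS exprS; ring.
Qed.

Lemma iota_one i : iota i one = 0.
Proof.
apply/ffunP => S; rewrite iota_coef ffunE ext_zeroE; case: ifP => // _.
by rewrite setU_eq0 -cards_eq0 cards1 mulr0.
Qed.

Lemma iota_wedge i a b :
  iota i (wedge a b) = wedge (iota i a) b + wedge (gradeinv a) (iota i b).
Proof.
elim/exterior_ind: a => [|j a IH||k a a' Ha Ha'].
- by rewrite wedge1l iota_one wedge0l gradeinv_one wedge1l add0r.
- rewrite wedge_epsl !iota_eps IH wedgeDl wedgeZl wedgeNl wedge_epsl gradeinv_eps.
  by rewrite wedgeNl wedge_epsl linearD opprD addrA.
- by rewrite wedge0l !linear0 !wedge0l gradeinv0 wedge0l addr0.
- rewrite wedge_linearl !linearP /= gradeinv_lin !wedge_linearl Ha Ha'.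
  by rewrite scalerDr addrACA.
Qed.

Lemma wedge_epsr i a b : wedge a (eps i b) = eps i (wedge (gradeinv a) b).
Proof.
elim/exterior_ind: a => [|j a IH||k a a' Ha Ha'].
- by rewrite gradeinv_one !wedge1l.
- by rewrite wedge_epsl IH eps_anticomm gradeinv_eps wedgeNl wedge_epsl linearN.
- by rewrite gradeinv0 !wedge0l linear0.
- by rewrite wedge_linearl gradeinv_lin wedge_linearl linearP /= Ha Ha'.
Qed.

Lemma homogeneous0 k : homogeneous k (0 : exterior F n).
Proof. by move=> S _; rewrite ext_zeroE. Qed.

Lemma homogeneousP k (c : F) a b : homogeneous k a -> homogeneous k b ->
  homogeneous k (c *: a + b).
Proof. by move=> ha hb S kS; rewrite ext_addE ext_scaleE ha // hb // mulr0 addr0. Qed.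

Lemma homogeneousD k a b : homogeneous k a -> homogeneous k b -> homogeneous k (a + b).
Proof. by move=> ha hb; rewrite -[a]scale1r; exact: homogeneousP. Qed.

Lemma homogeneousZ k (c : F) a : homogeneous k a -> homogeneous k (c *: a).
Proof. by move=> ha; rewrite -[_ *: _]addr0; apply: homogeneousP => //; exact: homogeneous0. Qed.

Lemma homogeneous_sum k (I : Type) (r : seq I) (P : pred I) (f : I -> exterior F n) :
  (forall x : I, P x -> homogeneous k (f x)) ->
  homogeneous k (\sum_(x <- r | P x) f x).
Proof.
move=> hf; elim/big_ind: _ => //; [exact: homogeneous0|exact: homogeneousD].
Qed.

Lemma homogeneous_basis S : homogeneous #|S| (ext_basis F S).
Proof. by move=> T; rewrite ffunE; case: (T =P S) => [->|//]; rewrite eqxx. Qed.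

Lemma homogeneous_basis1 i : homogeneous 1 (ext_basis F [set i]).
Proof. by have := @homogeneous_basis [set i]; rewrite cards1. Qed.

Lemma homogeneous_one : homogeneous 0 one.
Proof. by rewrite -(cards0 'I_n); exact: homogeneous_basis. Qed.

Lemma homogeneous_wedge k l a b : homogeneous k a -> homogeneous l b ->
  homogeneous (k + l) (wedge a b).
Proof.
move=> ha hb S Skl; rewrite ffunE big1 // => A AS.
have [Ak|/ha->] := eqVneq #|A| k; last by rewrite mulr0 mul0r.
rewrite hb ?mulr0 //; apply: contra Skl => /eqP <-.
by rewrite -Ak cardsDS // subnKC // subset_leq_card.
Qed.

Lemma homogeneous_eps k i a : homogeneous k a -> homogeneous k.+1 (eps i a).
Proof.
by move=> ha; exact: (homogeneous_wedge (homogeneous_basis1 i) ha).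
Qed.

Lemma homogeneous_iota k i a : homogeneous k.+1 a -> homogeneous k (iota i a).
Proof.
move=> ha S Sk; rewrite iota_coef; case: ifP => // iS.
by rewrite ha ?mulr0 // cardsU1 iS.
Qed.

Lemma iota_homogeneous0 i a : homogeneous 0 a -> iota i a = 0.
Proof.
move=> ha; apply/ffunP => S; rewrite iota_coef ext_zeroE; case: ifP => // iS.
by rewrite ha ?mulr0 // cardsU1 iS.
Qed.

Lemma homogeneous_gt k a : (n < k)%N -> homogeneous k a -> a = 0.
Proof.
move=> nk ha; apply/ffunP => S; rewrite ext_zeroE ha //.
by rewrite neq_ltn (leq_ltn_trans _ nk) // -[n in leqRHS]card_ord max_card.
Qed.

(** Euler's formula: the summand of index i keeps the coefficients a_S with i in
    S, so a_S is counted once for each element of S. *)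
Lemma eps_iota_sum k a : homogeneous k a -> \sum_i eps i (iota i a) = k%:R *: a.
Proof.
move=> ha; apply/ffunP => S; rewrite sum_ffunE ext_scaleE.
have E i : eps i (iota i a) S = if i \in S then a S else 0.
  rewrite eps_coef iota_coef; case: ifP => // iS.
  by rewrite setD11 setD1K // mulrA shuffle_sign_sqr mul1r.
under eq_bigr do rewrite E.
rewrite -big_mkcond sumr_const.
have [->|/ha ->] := eqVneq #|S| k; first by rewrite mulr_natl.
by rewrite mul0rn mulr0.
Qed.

Lemma gradeinv_even k a : ~~ odd k -> homogeneous k a -> gradeinv a = a.
Proof.
move=> ek ha; apply/ffunP => S; rewrite ffunE.
have [Sk|/ha ->] := eqVneq #|S| k; last by rewrite mulr0.
by rewrite -signr_odd Sk (negPf ek) mul1r.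
Qed.

(** By wedge_epsr an even form moves past each of the factors e_i of b. *)
Lemma even_wedgeC a b : gradeinv a = a -> wedge a b = wedge b a.
Proof.
move=> ea; elim/exterior_ind: b => [|j b IH||k b b' Hb Hb'].
- by rewrite wedge1l wedge1r.
- by rewrite wedge_epsr ea IH wedge_epsl.
- by rewrite wedge0l linear0.
- by rewrite linearP /= wedge_linearl Hb Hb'.
Qed.

End ExteriorAlgebra.

Section Exponential.
Variables (F : numFieldType) (n : nat).
Hypothesis n_le5 : (n <= 5)%N.
Implicit Types (a b c : exterior F n) (i j : 'I_n) (X : 'rV[F]_n).

Local Notation one := (ext_basis F set0 : exterior F n).
Local Notation iota i := (interior_product (delta_mx 0 i)).

(** The full exponential series of a 2-form in dimension at most 5, where the
    cube vanishes (cube_2form). *)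
Definition exp_form b : exterior F n := one + b + 2^-1 *: wedge b b.

Variables (b : exterior F n) (hb : homogeneous 2 b).

Lemma cube_2form : wedge b (wedge b b) = 0.
Proof.
apply: (@homogeneous_gt _ _ 6) => //.
by have := homogeneous_wedge hb (homogeneous_wedge hb hb).
Qed.

Lemma wedge_2formC a : wedge b a = wedge a b.
Proof. by apply/even_wedgeC/(gradeinv_even _ hb). Qed.

Lemma gradeinv_exp_form : gradeinv (exp_form b) = exp_form b.
Proof.
have h4 : homogeneous 4 (wedge b b) := homogeneous_wedge hb hb.
rewrite /exp_form addrC gradeinv_lin (gradeinv_even _ h4) // -[one]scale1r gradeinv_lin.
by rewrite gradeinv_one (gradeinv_even _ hb).
Qed.

Lemma iota_wedge_2form i a :
  iota i (wedge b a) = wedge (iota i b) a + wedge b (iota i a).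
Proof. by rewrite iota_wedge (gradeinv_even _ hb). Qed.

(** This is a third of the contraction of b /\ b /\ b = 0. *)
Lemma iota_2form_sqr i : wedge (iota i b) (wedge b b) = 0.
Proof.
have : iota i (wedge b (wedge b b)) = 0 by rewrite cube_2form linear0.
rewrite !iota_wedge_2form [wedge b (iota i b)]wedge_2formC linearD /=.
rewrite -!wedgeA [wedge b (iota i b)]wedge_2formC !wedgeA addrA -mulr2n -mulrSr.
by move/eqP; rewrite -scaler_nat scaler_eq0 pnatr_eq0 => /eqP.
Qed.

(** The term that the truncated series seems to lack is zero by iota_2form_sqr. *)
Lemma iota_exp_form i : iota i (exp_form b) = wedge (iota i b) (exp_form b).
Proof.
rewrite /exp_form !linearD !linearZ /= iota_one add0r iota_wedge_2form.
rewrite [wedge b (iota i b)]wedge_2formC wedge1r iota_2form_sqr scaler0 addr0.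
by rewrite -mulr2n -scaler_nat scalerA mulVf ?scale1r ?pnatr_eq0.
Qed.

Lemma exp_formC a : wedge (exp_form b) a = wedge a (exp_form b).
Proof. exact/even_wedgeC/gradeinv_exp_form. Qed.

Lemma iota_exp_form_wedge i a :
  iota i (wedge (exp_form b) a) = wedge (exp_form b) (iota i a + wedge (iota i b) a).
Proof.
rewrite iota_wedge gradeinv_exp_form iota_exp_form -exp_formC wedgeA addrC.
by rewrite [in RHS]linearD.
Qed.

Lemma interior_exp_form_wedge X a : interior_product X (wedge (exp_form b) a) =
  wedge (exp_form b) (interior_product X a + wedge (interior_product X b) a).
Proof.
rewrite !interior_productE wedge_suml -big_split linear_sum /=; apply: eq_bigr => i _.
by rewrite iota_exp_form_wedge wedgeZl -scalerDr linearZ /=.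
Qed.

(** The B-field transform: exp b conjugates X + xi to X + xi + i_X b. *)
Lemma rho_exp_form e a : rho e (wedge (exp_form b) a) =
  wedge (exp_form b) (rho e a + wedge (interior_product e.1 b) a).
Proof.
rewrite /rho interior_exp_form_wedge -wedgeA -exp_formC wedgeA -linearD /=.
by rewrite addrAC.
Qed.

Lemma exp_form_wedgeN : wedge (exp_form b) (exp_form (- b)) = one.
Proof.
rewrite /exp_form; set q := wedge b b.
have q4 : wedge q q = 0 by rewrite /q wedgeA cube_2form wedge0r.
have bq : wedge b q = 0 by exact: cube_2form.
have qb : wedge q b = 0 by rewrite /q wedgeA.
rewrite wedgeNl wedgeNr opprK -/q.
rewrite !(wedgeDl, wedgeDr, wedgeZl, wedgeZr, wedgeNl, wedgeNr, wedge1l, wedge1r).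
rewrite -/q bq qb q4; apply/ffunP => S; rewrite !(ext_addE, ext_scaleE, ext_oppE, ext_zeroE).
by field; rewrite ?pnatr_eq0.
Qed.

Lemma exp_form_wedgeK a : wedge (exp_form b) (wedge (exp_form (- b)) a) = a.
Proof. by rewrite -wedgeA exp_form_wedgeN wedge1l. Qed.

End Exponential.

Lemma exp_form_wedgeNK (F : numFieldType) (n : nat) (n_le5 : (n <= 5)%N)
    (b a : exterior F n) : homogeneous 2 b ->
  wedge (exp_form (- b)) (wedge (exp_form b) a) = a.
Proof.
move=> hb; rewrite -{2}(opprK b); apply: exp_form_wedgeK => //.
by rewrite -scaleN1r; exact: homogeneousZ.
Qed.

Lemma exp_form_wedge_inj (F : numFieldType) (n : nat) (n_le5 : (n <= 5)%N)
    (b a : exterior F n) : homogeneous 2 b ->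
  (wedge (exp_form b) a == 0) = (a == 0).
Proof.
move=> hb; apply/eqP/eqP => [E|->]; last exact: wedge0r.
by rewrite -(exp_form_wedgeNK n_le5 a hb) E wedge0r.
Qed.

Section ScalarExtension.
Variables (F K : fieldType) (h : {rmorphism F -> K}) (n : nat).
Implicit Types (a b : exterior F n) (S : {set 'I_n}).

(** Extension of scalars; h is the inclusion of the real numbers in the complex
    numbers, or complex conjugation. *)
Definition map_ext a : exterior K n := [ffun S : {set 'I_n} => h (a S)].

Lemma map_extD a b : map_ext (a + b) = map_ext a + map_ext b.
Proof. by apply/ffunP => S; rewrite !ffunE rmorphD. Qed.

Lemma map_extN a : map_ext (- a) = - map_ext a.
Proof. by apply/ffunP => S; rewrite !ffunE rmorphN. Qed.

Lemma map_extZ c a : map_ext (c *: a) = h c *: map_ext a.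
Proof. by apply/ffunP => S; rewrite !ffunE rmorphM. Qed.

Lemma map_ext0 : map_ext 0 = 0.
Proof. by apply/ffunP => S; rewrite !ffunE rmorph0. Qed.

Lemma map_ext_sum (I : Type) (r : seq I) (f : I -> exterior F n) :
  map_ext (\sum_(i <- r) f i) = \sum_(i <- r) map_ext (f i).
Proof.
by elim: r => [|i r IH]; rewrite ?big_nil ?map_ext0 // !big_cons map_extD IH.
Qed.

Lemma map_ext_basis S : map_ext (ext_basis F S) = ext_basis K S.
Proof. by apply/ffunP => T; rewrite !ffunE rmorph_nat. Qed.

Lemma map_ext_wedge a b : map_ext (wedge a b) = wedge (map_ext a) (map_ext b).
Proof.
apply/ffunP => S; rewrite !ffunE rmorph_sum; apply: eq_bigr => A _ /=.
by rewrite !rmorphM !ffunE /shuffle_sign rmorphXn rmorphN1.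
Qed.

Lemma map_ext_interior (X : 'rV[F]_n) a :
  map_ext (interior_product X a) = interior_product (map_mx h X) (map_ext a).
Proof.
apply/ffunP => S; rewrite !ffunE rmorph_sum; apply: eq_bigr => A _ /=.
by rewrite !rmorphM !ffunE mxE /shuffle_sign rmorphXn rmorphN1.
Qed.

Lemma map_ext_covector (xi : 'rV[F]_n) :
  map_ext (covector xi) = covector (map_mx h xi).
Proof.
rewrite /covector map_ext_sum; apply: eq_bigr => i _.
by rewrite map_extZ map_ext_basis mxE.
Qed.

Lemma homogeneous_map_ext k a : homogeneous k a -> homogeneous k (map_ext a).
Proof. by move=> ha S kS; rewrite ffunE ha // rmorph0. Qed.

End ScalarExtension.

Section Homogeneous.
Variables (F : numFieldType) (n : nat).
Implicit Types (a : exterior F n) (k : nat).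

Definition degree_part k a : exterior F n := [ffun S : {set 'I_n} => if #|S| == k then a S else 0].

Lemma homogeneous_degree_part k a : homogeneous k (degree_part k a).
Proof. by move=> S /negPf Sk; rewrite ffunE Sk. Qed.

Lemma degree_part_id k a : homogeneous k a -> degree_part k a = a.
Proof. by move=> ha; apply/ffunP => S; rewrite ffunE; case: eqVneq => // /ha ->. Qed.

Lemma degree_part_neq k l a : k != l -> homogeneous k a -> degree_part l a = 0.
Proof.
move=> kl ha; apply/ffunP => S; rewrite !ffunE; case: eqP => // Sl.
by rewrite ha // Sl eq_sym.
Qed.

Lemma hpartD k a b : degree_part k (a + b) = degree_part k a + degree_part k b.
Proof. by apply/ffunP => S; rewrite !ffunE; case: ifP; rewrite ?addr0. Qed.

Lemma degree_part_is_linear k : linear (degree_part k).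
Proof. by move=> c a b; apply/ffunP => S; rewrite !ffunE; case: ifP; rewrite ?scaler0 ?addr0. Qed.

HB.instance Definition _ k :=
  GRing.isLinear.Build F (exterior F n) (exterior F n) *:%R
    (degree_part k) (degree_part_is_linear k).

Lemma sum_degree_part a m : (n <= m)%N -> \sum_(k < m.+1) degree_part k a = a.
Proof.
move=> nm; apply/ffunP => S; rewrite sum_ffunE.
have Sm : (#|S| < m.+1)%N by rewrite ltnS (leq_trans _ nm) // -[leqRHS]card_ord max_card.
rewrite (bigD1 (Ordinal Sm)) //= ffunE eqxx big1 ?addr0 // => k kS.
rewrite ffunE; case: eqP => // E; case/eqP: kS; exact: val_inj.
Qed.

Lemma homogeneous0_one a : homogeneous 0 a -> a = a finset.set0 *: ext_basis F finset.set0.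
Proof.
move=> ha; apply/ffunP => S; rewrite ext_scaleE ffunE; case: eqP => [->|/eqP S0].
  by rewrite mulr1.
by rewrite mulr0 ha // cards_eq0.
Qed.

Lemma homogeneous1_covector a : homogeneous 1 a ->
  a = covector (\row_i a [set i]).
Proof.
move=> ha; apply/ffunP => S; rewrite /covector sum_ffunE.
have [/cards1P[j ->]|S1] := boolP (#|S| == 1%N).
  rewrite (bigD1 j) //= big1 => [|i ij]; first by rewrite ext_scaleE mxE ffunE eqxx mulr1 addr0.
  by rewrite ext_scaleE ffunE (inj_eq set1_inj) eq_sym (negPf ij) mulr0.
rewrite ha // big1 // => i _; rewrite ext_scaleE ffunE; case: eqP => [E|_]; last by rewrite mulr0.
by rewrite E cards1 in S1.
Qed.

End Homogeneous.

(** * Contraction with the Poisson bivector *)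

(** L, the contraction with the Poisson bivector inverse to Omega; the order of the
    factors is such that L Omega = 2. *)
HB.lock Definition contr (F : numFieldType) (a : exterior F 4) : exterior F 4 :=
  interior_product (delta_mx 0 ip1) (interior_product (delta_mx 0 iq1) a) +
  interior_product (delta_mx 0 ip2) (interior_product (delta_mx 0 iq2) a).

Section Symplectic.
Variable F : numFieldType.
Implicit Types (a b : exterior F 4) (i j : 'I_4) (k : nat).

Local Notation eps i := (wedge (ext_basis F [set i])).
Local Notation iota i := (interior_product (delta_mx 0 i)).

Lemma ord4P i : [\/ i = iq1, i = iq2, i = ip1 | i = ip2].
Proof.
case: i => [[|[|[|[|//]]]]] lt; [apply: Or41|apply: Or42|apply: Or43|apply: Or44];
  exact: val_inj.
Qed.

Lemma big_ord4 (V : nmodType) (f : 'I_4 -> V) :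
  \sum_i f i = f iq1 + f iq2 + f ip1 + f ip2.
Proof.
rewrite !big_ord_recl big_ord0 addr0 !addrA.
by congr (_ + _ + _ + _); congr f; exact: val_inj.
Qed.

Definition symp : exterior F 4 :=
  wedge (ext_basis F [set iq1]) (ext_basis F [set ip1]) +
  wedge (ext_basis F [set iq2]) (ext_basis F [set ip2]).

Lemma contrE a : contr a = iota ip1 (iota iq1 a) + iota ip2 (iota iq2 a).
Proof. by rewrite contr.unlock. Qed.

Definition conjugate_index i : 'I_4 :=
  if i == iq1 then ip1 else if i == iq2 then ip2 else if i == ip1 then iq1 else iq2.

Definition conjugate_sign i : F := if (i == iq1) || (i == iq2) then 1 else -1.

(** Chosen so that contr_eps holds: the commutator of contr with eps i is a contraction
    with the Hamiltonian vector of the coordinate i. *)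
Definition bracket i a := - conjugate_sign (conjugate_index i) *: iota (conjugate_index i) a.

Lemma contr_linear c a b : contr (c *: a + b) = c *: contr a + contr b.
Proof.
by rewrite !contrE !(interior_productD, interior_productZ) scalerDr addrACA.
Qed.

HB.instance Definition _ :=
  GRing.isLinear.Build F (exterior F 4) (exterior F 4) *:%R (@contr F) contr_linear.

Lemma contrD a b : contr (a + b) = contr a + contr b.
Proof. exact: linearD. Qed.

Lemma contrZ c a : contr (c *: a) = c *: contr a.
Proof. exact: linearZ. Qed.

Lemma contr0 : contr (0 : exterior F 4) = 0.
Proof. exact: linear0. Qed.

Lemma bracket_linear i : linear (bracket i).
Proof.
move=> c a b; rewrite /bracket !(interior_productD, interior_productZ).
by rewrite scalerDr !scalerA [_ * c]mulrC.
Qed.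

HB.instance Definition _ i :=
  GRing.isLinear.Build F (exterior F 4) (exterior F 4) *:%R (bracket i) (bracket_linear i).

Lemma bracketD i a b : bracket i (a + b) = bracket i a + bracket i b.
Proof. exact: linearD. Qed.

Lemma bracketZ i c a : bracket i (c *: a) = c *: bracket i a.
Proof. exact: linearZ. Qed.

Lemma contr_eps i a : contr (eps i a) = eps i (contr a) + bracket i a.
Proof.
have pair_eps (p q : 'I_4) : iota p (iota q (eps i a)) =
    (q == i)%:R *: iota p a - (p == i)%:R *: iota q a + eps i (iota p (iota q a)).
  rewrite iota_eps interior_productD interior_productN interior_productZ [iota p (eps _ _)]iota_eps.
  by rewrite opprB addrA addrAC.
rewrite !contrE !pair_eps wedgeDr /bracket /conjugate_index /conjugate_sign.
case: (ord4P i) => -> /=; rewrite ?eqE /= ?scale0r ?scale1r; apply/ffunP => S;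
  rewrite !(ext_addE, ext_scaleE, ext_oppE, ext_zeroE); ring.
Qed.

Lemma contr_iota i a : contr (iota i a) = iota i (contr a).
Proof.
have pair_iota (p q : 'I_4) : iota p (iota q (iota i a)) = iota i (iota p (iota q a)).
  by rewrite [iota q (iota i a)]iota_anticomm interior_productN
    [iota p (iota i _)]iota_anticomm opprK.
by rewrite !contrE !pair_iota interior_productD.
Qed.

Lemma contr_bracket i a : contr (bracket i a) = bracket i (contr a).
Proof. by rewrite /bracket contrZ contr_iota. Qed.

Lemma bracket_anticomm i j a : bracket i (bracket j a) = - bracket j (bracket i a).
Proof.
rewrite /bracket !interior_productZ iota_anticomm scalerN scalerN !scalerA.
by rewrite mulrC.
Qed.

Lemma homogeneous_contr k a : homogeneous k.+2 a -> homogeneous k (contr a).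
Proof. by move=> ha; rewrite contrE; apply: homogeneousD; do 2!apply: homogeneous_iota. Qed.

Lemma contr_homogeneous0 a : homogeneous 0 a -> contr a = 0.
Proof. by move=> ha; rewrite !contrE !(iota_homogeneous0 _ ha) !interior_product0 addr0. Qed.

Lemma contr_homogeneous1 a : homogeneous 1 a -> contr a = 0.
Proof.
move=> ha; have h i : homogeneous 0 (iota i a) by exact: homogeneous_iota.
by rewrite !contrE !(iota_homogeneous0 _ (h _)) addr0.
Qed.

Lemma homogeneous_bracket i k a : homogeneous k.+1 a -> homogeneous k (bracket i a).
Proof. by move=> ha; apply/homogeneousZ/homogeneous_iota. Qed.

Lemma bracket_homogeneous0 i a : homogeneous 0 a -> bracket i a = 0.
Proof. by move=> ha; rewrite /bracket iota_homogeneous0 // scaler0. Qed.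

(** contr is the sum of two commuting operators of square zero. *)
Lemma contr_cube a : contr (contr (contr a)) = 0.
Proof.
pose A p q x : exterior F 4 := iota p (iota q x).
have AA p q x : A p q (A p q x) = 0.
  by rewrite /A [iota q (iota p _)]iota_anticomm iota_iota0
    interior_product0 oppr0 interior_product0.
have AC p q r s x : A p q (A r s x) = A r s (A p q x).
  have AiC i y : A p q (iota i y) = iota i (A p q y).
    by rewrite /A [iota q (iota i y)]iota_anticomm interior_productN
    [iota p (iota i _)]iota_anticomm opprK.
  by rewrite {2 3}/A !AiC.
have AD p q x y : A p q (x + y) = A p q x + A p q y by rewrite /A !interior_productD.
have cE x : contr x = A ip1 iq1 x + A ip2 iq2 x by exact: contrE.
rewrite !cE !AD !AA (AC ip2 iq2 ip1 iq1 (A ip2 iq2 a)) !AA !(AC ip2 iq2 ip1 iq1) !AA.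
by rewrite /A !interior_product0 !addr0.
Qed.

Lemma wedge_symp a : wedge symp a = eps iq1 (eps ip1 a) + eps iq2 (eps ip2 a).
Proof. by rewrite /symp wedgeDl !wedge_epsl. Qed.

Lemma homogeneous_symp : homogeneous 2 symp.
Proof.
by apply: homogeneousD; apply: homogeneous_eps; exact: homogeneous_basis1.
Qed.

Lemma iota_symp i : iota i symp = conjugate_sign i *: ext_basis F [set conjugate_index i].
Proof.
have e2 p q : iota i (wedge (ext_basis F [set p]) (ext_basis F [set q])) =
    (i == p)%:R *: ext_basis F [set q] - (i == q)%:R *: ext_basis F [set p].
  rewrite iota_eps -{2}(wedge1r (ext_basis F [set q])) iota_eps iota_one wedge0r subr0.
  by rewrite wedgeZr wedge1r.
rewrite /symp interior_productD !e2 /conjugate_index /conjugate_sign.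
case: (ord4P i) => -> /=; rewrite ?eqE /= ?scale0r ?scale1r; apply/ffunP => S;
  rewrite !(ext_addE, ext_scaleE, ext_oppE, ext_zeroE); ring.
Qed.

(** The sl_2 relation: the commutator of L and Omega /\ _ is 2 - k on k-forms. *)
Lemma contr_symp a :
  contr (wedge symp a) = wedge symp (contr a) + 2 *: a - \sum_i eps i (iota i a).
Proof.
rewrite big_ord4 !wedge_symp contrD !contr_eps !wedgeDr.
have phiq1 x : bracket iq1 x = iota ip1 x by rewrite /bracket /conjugate_sign /= opprK scale1r.
have phiq2 x : bracket iq2 x = iota ip2 x by rewrite /bracket /conjugate_sign /= opprK scale1r.
have phip1 x : bracket ip1 x = - iota iq1 x by rewrite /bracket /conjugate_sign /= scaleN1r.
have phip2 x : bracket ip2 x = - iota iq2 x by rewrite /bracket /conjugate_sign /= scaleN1r.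
rewrite phiq1 phiq2 phip1 phip2 !iota_eps ?eqE /= !wedgeNr.
by apply/ffunP => S; rewrite !(ext_addE, ext_scaleE, ext_oppE, ext_zeroE); ring.
Qed.

Lemma contr_symp1 a : homogeneous 1 a -> contr (wedge symp a) = a.
Proof.
move=> ha; rewrite contr_symp (eps_iota_sum ha) contr_homogeneous1 // wedge0r add0r.
have -> : 2 *: a - 1%:R *: a = (2 - 1%:R) *: a by rewrite scalerBl.
have -> : 2 - 1%:R = 1 :> F by ring.
exact: scale1r.
Qed.

(** Omega /\ a has degree 5 and vanishes, so contr_symp reads 0 = 2 a - 3 a. *)
Lemma contr_inj3 a : homogeneous 3 a -> contr a = 0 -> a = 0.
Proof.
move=> ha ca; have := contr_symp a.
have -> : wedge symp a = 0.
  by apply: (@homogeneous_gt _ _ 5) => //; exact: (homogeneous_wedge homogeneous_symp ha).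
rewrite (eps_iota_sum ha) ca contr0 wedge0r add0r -scalerBl.
have -> : 2 - 3%:R = -1 :> F by ring.
by rewrite scaleN1r => /eqP; rewrite eq_sym oppr_eq0 => /eqP.
Qed.

End Symplectic.

Section ExpContr.
Variable F : numFieldType.
Implicit Types (a b : exterior F 4) (i j : 'I_4) (k : nat) (c t : F).

Local Notation one := (ext_basis F set0 : exterior F 4).
Local Notation eps i := (wedge (ext_basis F [set i])).
Local Notation iota i := (interior_product (delta_mx 0 i)).

(** The exponential of c L, which stops after the square by contr_cube. *)
Definition exp_contr c a : exterior F 4 :=
  a + c *: contr a + (c ^+ 2 / 2) *: contr (contr a).

Lemma exp_contr_linear c : linear (exp_contr c).
Proof.
move=> k a b; rewrite /exp_contr !(contrD, contrZ).
apply/ffunP => S; rewrite !(ext_addE, ext_scaleE, ext_oppE, ext_zeroE); ring.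
Qed.

HB.instance Definition _ c :=
  GRing.isLinear.Build F (exterior F 4) (exterior F 4) *:%R (exp_contr c) (exp_contr_linear c).

(** This is a third of the commutator of L^3 = 0 with eps i. *)
Lemma bracket_contr_contr i a : bracket i (contr (contr a)) = 0.
Proof.
have := contr_cube (eps i a).
rewrite !(contr_eps, contrD) contr_cube wedge0r add0r !contr_bracket.
rewrite -mulr2n -mulrSr -scaler_nat => /eqP.
by rewrite scaler_eq0 pnatr_eq0 => /eqP.
Qed.

Lemma exp_contr_iota c i a : exp_contr c (iota i a) = iota i (exp_contr c a).
Proof. by rewrite /exp_contr !interior_productD !interior_productZ !contr_iota. Qed.

Lemma exp_contr_bracket c i a : exp_contr c (bracket i a) = bracket i (exp_contr c a).
Proof. by rewrite /bracket linearZ /= exp_contr_iota. Qed.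

(** exp (c L) conjugates eps i to eps i + c [L, eps i]; there are no further
    terms because [L, eps i] is a contraction and commutes with L. *)
Lemma exp_contr_eps c i a :
  exp_contr c (eps i a) = eps i (exp_contr c a) + c *: bracket i (exp_contr c a).
Proof.
rewrite /exp_contr !(contr_eps, contrD) !(wedgeDr, wedgeZr, bracketD, bracketZ) bracket_contr_contr.
rewrite !contr_bracket; apply/ffunP => S; rewrite !(ext_addE, ext_scaleE, ext_oppE, ext_zeroE).
by field; rewrite ?pnatr_eq0.
Qed.

Lemma exp_contrK c a : exp_contr c (exp_contr (- c) a) = a.
Proof.
rewrite /exp_contr !(contrD, contrZ) !contr_cube !contr0.
apply/ffunP => S; rewrite !(ext_addE, ext_scaleE, ext_oppE, ext_zeroE).
by field; rewrite ?pnatr_eq0.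
Qed.

Lemma exp_contr_homogeneous0 c a : homogeneous 0 a -> exp_contr c a = a.
Proof. by move=> ha; rewrite /exp_contr contr_homogeneous0 // contr0 !scaler0 !addr0. Qed.

Lemma conjugate_indexK i : conjugate_index (conjugate_index i) = i.
Proof. by case: (ord4P i) => ->. Qed.

Lemma conjugate_sign_neq0 i : conjugate_sign F i != 0.
Proof. by rewrite /conjugate_sign; case: ifP; rewrite ?oppr_eq0 oner_eq0. Qed.

Lemma conjugate_sign_sqr i : conjugate_sign F i * conjugate_sign F i = 1.
Proof. by rewrite /conjugate_sign; case: ifP; rewrite ?mulrNN mulr1. Qed.

(** The choice c = - 1 / t comes from here. Since bracket (conjugate_index i) is
    iota i up to sign, for this c the operator on the left-hand side is a multiple
    of eps + c bracket at the conjugate index, which exp (c L) turns into eps. *)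
Lemma iota_symp_exp_contr t i a : t != 0 ->
  iota i (exp_contr (- t^-1) a) + t *: wedge (iota i (symp F)) (exp_contr (- t^-1) a)
    = (t * conjugate_sign F i) *: exp_contr (- t^-1) (eps (conjugate_index i) a).
Proof.
move=> t0; rewrite exp_contr_eps iota_symp wedgeZl /bracket conjugate_indexK.
move: (exp_contr _ a) => x.
have E : t * conjugate_sign F i * (- t^-1 * - conjugate_sign F i) = 1.
  by rewrite mulrNN mulrACA mulfV // mul1r conjugate_sign_sqr.
by rewrite scalerDr !scalerA addrC -[_ * _ * - conjugate_sign F i]mulrA E scale1r.
Qed.

(** The frame in which the decomposition into the U_k is the decomposition by
    degree (pi_weight). *)
Definition frame b c a : exterior F 4 := wedge (exp_form b) (exp_contr c a).

Definition unframe b c a : exterior F 4 := exp_contr (- c) (wedge (exp_form (- b)) a).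

Lemma frameK b c a : homogeneous 2 b -> unframe b c (frame b c a) = a.
Proof. by move=> hb; rewrite /unframe /frame exp_form_wedgeNK // -{2}(opprK c) exp_contrK. Qed.

Lemma unframeK b c a : homogeneous 2 b -> frame b c (unframe b c a) = a.
Proof. by move=> hb; rewrite /unframe /frame exp_contrK exp_form_wedgeK. Qed.

Lemma frame_is_linear b c : linear (frame b c).
Proof. by move=> k a a'; rewrite /frame !linearP. Qed.

HB.instance Definition _ b c :=
  GRing.isLinear.Build F (exterior F 4) (exterior F 4) *:%R (frame b c) (frame_is_linear b c).

Lemma frame_one b c : frame b c one = exp_form b.
Proof. by rewrite /frame exp_contr_homogeneous0 ?wedge1r //; exact: homogeneous_one. Qed.

(** In the frame, the generalized vector X - i_X b' acts as the exterior
    multiplication by t i_X Omega. Every covector is of this form, as Omega is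
    nondegenerate. *)
Lemma rho_frame b b' t (e : 'rV[F]_4 * 'rV[F]_4) a : homogeneous 2 b -> t != 0 ->
    b - b' = t *: symp F -> covector e.2 + interior_product e.1 b' = 0 ->
  rho e (frame b (- t^-1) a) =
  \sum_i (e.1 0 i * (t * conjugate_sign F i)) *: frame b (- t^-1) (eps (conjugate_index i) a).
Proof.
move=> hb t0 bb' /eqP; rewrite addr_eq0 => /eqP eE; rewrite /frame rho_exp_form //.
move: (iota_symp_exp_contr (t := t)) => HE.
have -> : rho e (exp_contr (- t^-1) a) + wedge (interior_product e.1 b) (exp_contr (- t^-1) a) =
    interior_product e.1 (exp_contr (- t^-1) a)
      + t *: wedge (interior_product e.1 (symp F)) (exp_contr (- t^-1) a).
  rewrite /rho eE wedgeNl -addrA; congr (_ + _).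
  rewrite addrC -wedgeNl -wedgeDl -interior_productN -interior_productD bb'.
  by rewrite interior_productZ wedgeZl.
rewrite !interior_productE wedge_suml scaler_sumr -big_split linear_sum /=.
apply: eq_bigr => i _.
have scalerCA (k l : F) v : k *: (l *: v) = l *: (k *: v) :> exterior F 4.
  by rewrite !scalerA mulrC.
by rewrite wedgeZl scalerCA -scalerDr HE // scalerA wedgeZr.
Qed.

End ExpContr.

(** * Differential operators on forms *)

(** The two instances are the real smooth functions with partial and the complex
    ones with cpartial. *)
Record derivations (M : Type) (F : fieldType) (n : nat)
    (regular : (M -> F) -> Prop) (D : 'I_n -> (M -> F) -> M -> F) : Prop := Derivations {
  regular_cst : forall c : F, regular (fun=> c);
  regularD : forall f g, regular f -> regular g -> regular (fun x => f x + g x);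
  regularM : forall f g, regular f -> regular g -> regular (fun x => f x * g x);
  regular_deriv : forall i f, regular f -> regular (D i f);
  deriv_cst : forall i (c : F), D i (fun=> c) = fun=> 0;
  derivD : forall i f g, regular f -> regular g ->
    D i (fun x => f x + g x) = fun x => D i f x + D i g x;
  derivM : forall i f g, regular f -> regular g ->
    D i (fun x => f x * g x) = fun x => D i f x * g x + f x * D i g x;
  deriv_comm : forall i j f, regular f -> D i (D j f) = D j (D i f) }.

Section Calculus.
Variables (M : Type) (F : numFieldType) (n : nat).
Variables (regular : (M -> F) -> Prop) (D : 'I_n -> (M -> F) -> M -> F).
Hypothesis HD : derivations regular D.
Implicit Types (f g : M -> F) (s t : M -> exterior F n) (i j : 'I_n).

Local Notation eps i := (wedge (ext_basis F [set i])).

Definition regular_form t := forall S, regular (fun x => t x S).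

Definition form_partial i t x : exterior F n := [ffun S : {set 'I_n} => D i (fun y => t y S) x].

(** For P = eps this is the exterior derivative d, and for P = bracket it is the
    commutator [L, d] (dLE). All the commutation rules between d, [L, d] and
    constant operators then follow from algebraic ones between symbols. *)
Definition symbol_deriv (P : 'I_n -> exterior F n -> exterior F n) t x : exterior F n :=
  \sum_i P i (form_partial i t x).

Local Notation d := (symbol_deriv (fun i => eps i)).

Lemma regular_sum (I : Type) (r : seq I) (P : pred I) (f : I -> M -> F) :
  (forall k, regular (f k)) -> regular (fun x => \sum_(k <- r | P k) f k x).
Proof.
move=> nf; elim: r => [|k r IH].
  have -> : (fun x => \sum_(k <- [::] | P k) f k x) = fun=> 0.
    by apply: funext => x; rewrite big_nil.
  exact: regular_cst HD _.
have -> : (fun x => \sum_(k <- k :: r | P k) f k x) =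
    fun x => (if P k then f k x else 0) + \sum_(k <- r | P k) f k x.
  by apply: funext => x; rewrite big_cons; case: ifP; rewrite ?add0r.
by apply: (regularD HD) => //; case: (P k) => //; exact: regular_cst HD _.
Qed.

Lemma deriv_sum (I : Type) (r : seq I) (P : pred I) (f : I -> M -> F) i :
    (forall k, regular (f k)) ->
  D i (fun x => \sum_(k <- r | P k) f k x) = fun x => \sum_(k <- r | P k) D i (f k) x.
Proof.
move=> nf; elim: r => [|k r IH].
  have -> : (fun x => \sum_(k <- [::] | P k) f k x) = fun=> 0.
    by apply: funext => x; rewrite big_nil.
  by rewrite (deriv_cst HD); apply: funext => x; rewrite big_nil.
have -> : (fun x => \sum_(k <- k :: r | P k) f k x) =
    fun x => (if P k then f k x else 0) + \sum_(k <- r | P k) f k x.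
  by apply: funext => x; rewrite big_cons; case: ifP; rewrite ?add0r.
rewrite (derivD HD) ?IH; last 2 first.
- by case: (P k) => //; exact: regular_cst HD _.
- exact: regular_sum.
apply: funext => x; rewrite big_cons; case: (P k) => //.
by rewrite (deriv_cst HD) add0r.
Qed.

Lemma deriv_mulc (c : F) i f : regular f ->
  D i (fun x => c * f x) = fun x => c * D i f x.
Proof.
move=> nf; rewrite (derivM HD) ?(deriv_cst HD) //; last exact: regular_cst HD _.
by apply: funext => x; rewrite mul0r add0r.
Qed.

Lemma regular_mulc (c : F) f : regular f -> regular (fun x => c * f x).
Proof. by move=> nf; apply: (regularM HD) => //; exact: regular_cst HD _. Qed.

Section LinearImage.
Variable A : exterior F n -> exterior F n.
Hypothesis linA : linear A.

(** A constant linear operator is a finite combination of coefficients with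
    constant factors, so it commutes with derivations (form_partial_linear). *)
Lemma linear_coefE a S : A a S = \sum_T A (ext_basis F T) S * a T.
Proof.
pose A' := GRing.isLinear.Build F (exterior F n) (exterior F n) *:%R A linA.
pose L : {linear exterior F n -> exterior F n} := HB.pack A A'.
rewrite -[A]/(L : _ -> _) {1}(exterior_basis a) linear_sum sum_ffunE.
by apply: eq_bigr => T _; rewrite linearZ ext_scaleE mulrC.
Qed.

Lemma regular_form_linear t : regular_form t -> regular_form (fun x => A (t x)).
Proof.
move=> nt S.
have -> : (fun x => A (t x) S) = fun x => \sum_T A (ext_basis F T) S * t x T.
  by apply: funext => x; rewrite linear_coefE.
by apply: regular_sum => T; exact: regular_mulc.
Qed.

Lemma form_partial_linear i t x : regular_form t ->
  form_partial i (fun y => A (t y)) x = A (form_partial i t x).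
Proof.
move=> nt; apply/ffunP => S; rewrite ffunE linear_coefE.
have -> : (fun x => A (t x) S) = fun x => \sum_T A (ext_basis F T) S * t x T.
  by apply: funext => y; rewrite linear_coefE.
rewrite deriv_sum => [|T]; last exact: regular_mulc.
by apply: eq_bigr => T _; rewrite deriv_mulc // ffunE.
Qed.

End LinearImage.

Lemma regular_form_partial i t : regular_form t -> regular_form (form_partial i t).
Proof.
move=> nt S; have -> : (fun x => form_partial i t x S) = D i (fun y => t y S).
  by apply: funext => x; rewrite ffunE.
exact: regular_deriv HD _ _ (nt S).
Qed.

Lemma regular_form0 : regular_form (fun=> 0).
Proof.
move=> S; have -> : (fun _ : M => (0 : exterior F n) S) = fun=> 0.
  by apply: funext => x; rewrite ext_zeroE.
exact: regular_cst HD _.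
Qed.

Lemma regular_form_add s t : regular_form s -> regular_form t -> regular_form (fun x => s x + t x).
Proof.
move=> ns nt S; have -> : (fun x => (s x + t x) S) = fun x => s x S + t x S.
  by apply: funext => x; rewrite ext_addE.
exact: regularD HD _ _ (ns S) (nt S).
Qed.

Lemma form_partial_add i s t x : regular_form s -> regular_form t ->
  form_partial i (fun y => s y + t y) x = form_partial i s x + form_partial i t x.
Proof.
move=> ns nt; apply/ffunP => S; rewrite ext_addE !ffunE.
have -> : (fun x => (s x + t x) S) = fun x => s x S + t x S.
  by apply: funext => y; rewrite ext_addE.
by rewrite (derivD HD).
Qed.

Lemma regular_form_scale f t : regular f -> regular_form t -> regular_form (fun x => f x *: t x).
Proof.
move=> nf nt S; have -> : (fun x => (f x *: t x) S) = fun x => f x * t x S.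
  by apply: funext => x; rewrite ext_scaleE.
exact: regularM HD _ _ nf (nt S).
Qed.

Lemma form_partial_scale i f t x : regular f -> regular_form t ->
  form_partial i (fun y => f y *: t y) x = D i f x *: t x + f x *: form_partial i t x.
Proof.
move=> nf nt; apply/ffunP => S; rewrite ext_addE !ext_scaleE !ffunE.
have -> : (fun x => (f x *: t x) S) = fun x => f x * t x S.
  by apply: funext => y; rewrite ext_scaleE.
by rewrite (derivM HD).
Qed.

Lemma form_partial_cst i (a : exterior F n) x : form_partial i (fun=> a) x = 0.
Proof. by apply/ffunP => S; rewrite ffunE (deriv_cst HD) ext_zeroE. Qed.

Lemma regular_form_cst (a : exterior F n) : regular_form (fun=> a).
Proof. by move=> S; exact: regular_cst HD _. Qed.

Lemma regular_form_sum (I : Type) (r : seq I) (t : I -> M -> exterior F n) :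
  (forall k, regular_form (t k)) -> regular_form (fun x => \sum_(k <- r) t k x).
Proof.
move=> nt S; have -> : (fun x => (\sum_(k <- r) t k x) S) = fun x => \sum_(k <- r) t k x S.
  by apply: funext => x; rewrite sum_ffunE.
by apply: regular_sum => k; exact: nt.
Qed.

Lemma form_partial_sum (I : Type) (r : seq I) (t : I -> M -> exterior F n) i x :
    (forall k, regular_form (t k)) ->
  form_partial i (fun y => \sum_(k <- r) t k y) x = \sum_(k <- r) form_partial i (t k) x.
Proof.
move=> nt; apply/ffunP => S; rewrite ffunE sum_ffunE.
have -> : (fun x => (\sum_(k <- r) t k x) S) = fun x => \sum_(k <- r) t k x S.
  by apply: funext => y; rewrite sum_ffunE.
by rewrite deriv_sum => [|k]; [apply: eq_bigr => k _; rewrite ffunE|exact: nt].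
Qed.

Let wedge_coefE a b S : wedge a b S =
  \sum_(A : {set 'I_n} | A \subset S) shuffle_sign F A (S :\: A) * (a A * b (S :\: A)).
Proof. by rewrite ffunE; apply: eq_bigr => A _; rewrite mulrA. Qed.

Lemma regular_form_wedge s t : regular_form s -> regular_form t ->
  regular_form (fun x => wedge (s x) (t x)).
Proof.
move=> ns nt S.
have -> : (fun x => wedge (s x) (t x) S) = fun x => \sum_(A : {set 'I_n} | A \subset S)
    shuffle_sign F A (S :\: A) * (s x A * t x (S :\: A)).
  by apply: funext => x; rewrite wedge_coefE.
by apply: regular_sum => A; apply: regular_mulc; exact: regularM HD _ _ (ns _) (nt _).
Qed.

Lemma form_partial_wedge i s t x : regular_form s -> regular_form t ->
  form_partial i (fun y => wedge (s y) (t y)) x =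
    wedge (form_partial i s x) (t x) + wedge (s x) (form_partial i t x).
Proof.
move=> ns nt; apply/ffunP => S; rewrite ffunE ext_addE !wedge_coefE.
have -> : (fun x => wedge (s x) (t x) S) = fun x => \sum_(A : {set 'I_n} | A \subset S)
    shuffle_sign F A (S :\: A) * (s x A * t x (S :\: A)).
  by apply: funext => y; rewrite wedge_coefE.
have nst A : regular (fun y => s y A * t y (S :\: A)) by exact: regularM HD _ _ (ns _) (nt _).
rewrite deriv_sum => [|A]; last exact: regular_mulc.
rewrite -big_split; apply: eq_bigr => A _ /=.
by rewrite deriv_mulc // (derivM HD) // !ffunE mulrDr.
Qed.

Lemma form_partial_comm i j t x : regular_form t ->
  form_partial i (form_partial j t) x = form_partial j (form_partial i t) x.
Proof.
move=> nt; apply/ffunP => S; rewrite !ffunE.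
have E k : (fun x => form_partial k t x S) = D k (fun y => t y S).
  by apply: funext => y; rewrite ffunE.
by rewrite !E (deriv_comm HD).
Qed.

Section Symbol.
Variable P : 'I_n -> exterior F n -> exterior F n.
Hypothesis linP : forall i, linear (P i).

Let P0 i : P i 0 = 0.
Proof.
have := linP i 0 0 0; rewrite scale0r addr0 scale0r add0r => E.
by have := linP i 1 0 0; rewrite !scale1r addr0 -[LHS]addr0 => /addrI <-.
Qed.

Let PD i a b : P i (a + b) = P i a + P i b.
Proof. by have := linP i 1 a b; rewrite !scale1r. Qed.

Let P_sum i (I : Type) (r : seq I) (f : I -> exterior F n) :
  P i (\sum_(k <- r) f k) = \sum_(k <- r) P i (f k).
Proof. by elim: r => [|k r IH]; rewrite ?big_nil ?P0 // !big_cons PD IH. Qed.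

Lemma regular_symbol_deriv t : regular_form t -> regular_form (symbol_deriv P t).
Proof.
by move=> nt; apply: regular_form_sum => i; apply/regular_form_linear/regular_form_partial.
Qed.

Lemma symbol_derivD s t x : regular_form s -> regular_form t ->
  symbol_deriv P (fun y => s y + t y) x = symbol_deriv P s x + symbol_deriv P t x.
Proof.
move=> ns nt; rewrite -big_split; apply: eq_bigr => i _ /=.
by rewrite form_partial_add // PD.
Qed.

(** The derivations commute and the symbols anticommute, so the double sum is its
    own opposite. *)
Lemma symbol_deriv_sqr t x : (forall i j a, P i (P j a) = - P j (P i a)) ->
  regular_form t -> symbol_deriv P (symbol_deriv P t) x = 0.
Proof.
move=> PP nt.
have E i : form_partial i (symbol_deriv P t) x = \sum_j P j (form_partial i (form_partial j t) x).
  rewrite form_partial_sum => [|j]; last by apply/regular_form_linear/regular_form_partial.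
  by apply: eq_bigr => j _; rewrite form_partial_linear //; exact: regular_form_partial.
rewrite /symbol_deriv; under eq_bigr do rewrite E P_sum.
set z := \sum_i _; suff : z = - z.
  move/eqP; rewrite -subr_eq0 opprK -mulr2n -scaler_nat scaler_eq0 pnatr_eq0.
  by move/eqP.
rewrite [in LHS]/z exchange_big /z -sumrN; apply: eq_bigr => i _ /=.
rewrite -sumrN; apply: eq_bigr => j _ /=.
by rewrite PP form_partial_comm.
Qed.

End Symbol.

End Calculus.

Section ExteriorDerivative.
Variables (M : Type) (F : numFieldType) (n : nat).
Variables (regular : (M -> F) -> Prop) (D : 'I_n -> (M -> F) -> M -> F).
Hypothesis HD : derivations regular D.
Implicit Types (f g : M -> F) (s t b : M -> exterior F n) (i j : 'I_n).

Local Notation one := (ext_basis F set0 : exterior F n).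
Local Notation eps i := (wedge (ext_basis F [set i])).
Local Notation d := (symbol_deriv D (fun i => eps i)).
Local Notation Regular := (regular_form regular).

Lemma homogeneous_form_partial k i t x : (forall y, homogeneous k (t y)) ->
  homogeneous k (form_partial D i t x).
Proof.
move=> ht S Sk; rewrite ffunE.
have -> : (fun y => t y S) = fun=> 0 by apply: funext => y; exact: ht.
by rewrite (deriv_cst HD).
Qed.

Lemma homogeneous_d k t x : (forall y, homogeneous k (t y)) -> homogeneous k.+1 (d t x).
Proof.
by move=> ht; apply: homogeneous_sum => i _; apply/homogeneous_eps/homogeneous_form_partial.
Qed.

Lemma regular_d t : Regular t -> Regular (d t).
Proof. by apply: regular_symbol_deriv => // i; exact: wedge_is_linear. Qed.

Lemma dD s t x : Regular s -> Regular t -> d (fun y => s y + t y) x = d s x + d t x.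
Proof. by apply: symbol_derivD => // i; exact: wedge_is_linear. Qed.

Lemma d_sqr t x : Regular t -> d (d t) x = 0.
Proof.
apply: symbol_deriv_sqr => // [i|i j a]; first exact: wedge_is_linear.
exact: eps_anticomm.
Qed.

Lemma d_scale f t x : regular f -> Regular t ->
  d (fun y => f y *: t y) x = wedge (d (fun y => f y *: one) x) (t x) + f x *: d t x.
Proof.
move=> nf nt; rewrite /symbol_deriv wedge_suml scaler_sumr -big_split.
apply: eq_bigr => i _ /=; rewrite !(form_partial_scale HD) //; last exact: (regular_form_cst HD).
by rewrite (form_partial_cst HD) scaler0 addr0 wedgeDr !wedgeZr wedge1r wedgeZl.
Qed.

Lemma d_wedge_even b t x : (forall y, gradeinv (b y) = b y) ->
    Regular b -> Regular t ->
  d (fun y => wedge (b y) (t y)) x = wedge (d b x) (t x) + wedge (b x) (d t x).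
Proof.
move=> eb nb nt; rewrite /symbol_deriv wedge_suml linear_sum -big_split.
apply: eq_bigr => i _ /=; rewrite (form_partial_wedge HD) // wedgeDr wedge_epsl.
by rewrite wedge_epsr eb.
Qed.

Lemma d_cst_scale (c : F) t x : Regular t -> d (fun y => c *: t y) x = c *: d t x.
Proof.
move=> nt; rewrite /symbol_deriv scaler_sumr; apply: eq_bigr => i _.
rewrite (form_partial_linear HD (A := fun a => c *: a)) // ?wedgeZr // => k a a'.
by rewrite scalerDr !scalerA mulrC.
Qed.

Lemma regular_opp t : Regular t -> Regular (fun y => - t y).
Proof.
move=> nt; have -> : (fun y => - t y) = fun y => (-1 : F) *: t y.
  by apply: funext => y; rewrite scaleN1r.
by apply: (regular_form_scale HD) => //; exact: regular_cst HD _.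
Qed.

Lemma dN t x : Regular t -> d (fun y => - t y) x = - d t x.
Proof.
move=> nt; rewrite -scaleN1r -d_cst_scale //; congr (symbol_deriv D _ _ x).
by apply: funext => y; rewrite scaleN1r.
Qed.

Section ClosedTwoForm.
Variable b : M -> exterior F n.
Hypotheses (hb : forall y, homogeneous 2 (b y)) (nb : Regular b).
Hypothesis closed_b : forall y, d b y = 0.

Lemma regular_exp_form : Regular (fun y => exp_form (b y)).
Proof.
have n1 := regular_form_cst HD one.
have n2 : Regular (fun y => 2^-1 *: wedge (b y) (b y)).
  apply: (regular_form_scale HD); [exact: regular_cst HD _|exact: (regular_form_wedge HD)].
exact: (regular_form_add HD (regular_form_add HD n1 nb) n2).
Qed.

(** A closed even form passes through d (d_wedge_even). *)
Lemma d_exp_form_wedge t x : Regular t ->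
  d (fun y => wedge (exp_form (b y)) (t y)) x = wedge (exp_form (b x)) (d t x).
Proof.
move=> nt.
have eb y : gradeinv (b y) = b y by exact: (gradeinv_even _ (hb y)).
have dw s y : Regular s -> d (fun z => wedge (b z) (s z)) y = wedge (b y) (d s y).
  by move=> ns; rewrite d_wedge_even // closed_b wedge0l add0r.
have nw s : Regular s -> Regular (fun z => wedge (b z) (s z)) by exact: (regular_form_wedge HD).
have E : (fun y => wedge (exp_form (b y)) (t y)) =
    fun y => t y + wedge (b y) (t y) + 2^-1 *: wedge (b y) (wedge (b y) (t y)).
  by apply: funext => y; rewrite /exp_form !(wedgeDl, wedgeZl) wedge1l wedgeA.
have nc s : Regular s -> Regular (fun z => 2^-1 *: s z).
  by move=> ns; apply: (regular_form_scale HD) => //; exact: regular_cst HD _.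
have n1 := nw _ nt; have n2 := nw _ n1.
rewrite E dD ?dD //; last exact: nc.
- rewrite d_cst_scale // !dw // /exp_form !(wedgeDl, wedgeZl) wedge1l wedgeA.
  by congr (_ + _ *: wedge _ _); exact: dw.
- exact: (regular_form_add HD).
Qed.

End ClosedTwoForm.

End ExteriorDerivative.

Section SymplecticDerivative.
Variables (M : Type) (F : numFieldType).
Variables (regular : (M -> F) -> Prop) (D : 'I_4 -> (M -> F) -> M -> F).
Hypothesis HD : derivations regular D.
Implicit Types (f g : M -> F) (s t b : M -> exterior F 4) (i j : 'I_4) (c : F).

Local Notation one := (ext_basis F set0 : exterior F 4).
Local Notation eps i := (wedge (ext_basis F [set i])).
Local Notation d := (symbol_deriv D (fun i => eps i)).
Local Notation dL := (symbol_deriv D (@bracket F)).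
Local Notation Regular := (regular_form regular).

Lemma regular_dL t : Regular t -> Regular (dL t).
Proof. by apply: regular_symbol_deriv => // i; exact: bracket_linear. Qed.

Lemma dL_sqr t x : Regular t -> dL (dL t) x = 0.
Proof.
apply: symbol_deriv_sqr => // [i|i j a]; first exact: bracket_linear.
exact: bracket_anticomm.
Qed.

Lemma dLE t x : Regular t -> dL t x = contr (d t x) - d (fun y => contr (t y)) x.
Proof.
move=> nt; rewrite /symbol_deriv linear_sum -sumrB; apply: eq_bigr => i _ /=.
rewrite contr_eps (form_partial_linear HD (A := @contr F)) //; last exact: contr_linear.
by rewrite addrAC subrr add0r.
Qed.

Lemma dL_exp_contr c t x : Regular t -> dL (fun y => exp_contr c (t y)) x = exp_contr c (dL t x).
Proof.
move=> nt; rewrite /symbol_deriv linear_sum; apply: eq_bigr => i _ /=.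
by rewrite (form_partial_linear HD (exp_contr_linear c)) // exp_contr_bracket.
Qed.

(** By exp_contr_eps, the symbol of d is conjugated to eps - c bracket. *)
Lemma d_exp_contr c t x : Regular t ->
  d (fun y => exp_contr c (t y)) x = exp_contr c (d t x - c *: dL t x).
Proof.
move=> nt; rewrite linearB linearZ /= -dL_exp_contr //.
rewrite /symbol_deriv linear_sum scaler_sumr -sumrB; apply: eq_bigr => i _ /=.
by rewrite (form_partial_linear HD (exp_contr_linear c)) // exp_contr_eps addrK.
Qed.

Lemma homogeneous_dL k t x : (forall y, homogeneous k.+1 (t y)) -> homogeneous k (dL t x).
Proof.
move=> ht; apply: homogeneous_sum => i _; apply: homogeneous_bracket.
exact: (homogeneous_form_partial HD).
Qed.

Lemma dL_homogeneous0 t x : (forall y, homogeneous 0 (t y)) -> dL t x = 0.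
Proof.
move=> ht; rewrite /symbol_deriv big1 // => i _; apply: bracket_homogeneous0.
exact: (homogeneous_form_partial HD).
Qed.

Section ClosedTwoForm.
Variables (b : M -> exterior F 4) (f : M -> F) (c : F).
Hypotheses (hb : forall y, homogeneous 2 (b y)) (nb : Regular b).
Hypothesis closed_b : forall y, d b y = 0.
Hypothesis nf : regular f.

Local Notation df := (d (fun y => f y *: one)).

(** [L, d] commutes with exp (- c L), and d does so up to a multiple of [L, d],
    which has square zero: both exponentials of L come out. There remains
    d (L d - d L) u for u = exp (- b) f, and d d = 0. Finally du = df - b /\ df, the
    next term having degree 5, and L df = 0. *)
Lemma d_dL_function x :
  d (dL (fun y => exp_contr (- c) (wedge (exp_form (- b y)) (f y *: one)))) x =
  - exp_contr (- c) (d (fun y => contr (wedge (b y) (df y))) x).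
Proof.
pose u y := wedge (exp_form (- b y)) (f y *: one).
have nNb : Regular (fun y => - b y) by exact: (regular_opp HD).
have hNb y : homogeneous 2 (- b y) by rewrite -scaleN1r; exact: homogeneousZ.
have n1 : Regular (fun y => f y *: one).
  by apply: (regular_form_scale HD) => //; exact: (regular_form_cst HD).
have nu : Regular u.
  by apply: (regular_form_wedge HD) => //; exact: (regular_exp_form HD).
have ndf : Regular df by exact: (regular_d HD).
have h1 y : homogeneous 1 (df y).
  by apply: (homogeneous_d HD) => z; exact/homogeneousZ/homogeneous_one.
have nL := regular_dL nu.
have -> : dL (fun y => exp_contr (- c) (u y)) = fun y => exp_contr (- c) (dL u y).
  by apply: funext => y; rewrite dL_exp_contr.
rewrite d_exp_contr // dL_sqr // scaler0 subr0 -linearN /=; congr (exp_contr _ _).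
have -> : dL u = fun y => contr (d u y) + - d (fun z => contr (u z)) y.
  by apply: funext => y; rewrite dLE.
have nc s : Regular s -> Regular (fun y => contr (s y)).
  by apply: (regular_form_linear HD); exact: contr_linear.
have ndu : Regular (d u) by exact: (regular_d HD).
have ndc : Regular (d (fun z => contr (u z))) by exact/(regular_d HD)/nc.
rewrite (dD HD); [|exact: nc|exact: (regular_opp HD)].
rewrite (dN HD) // (d_sqr HD); last exact: nc.
rewrite oppr0 addr0 -(dN HD); last first.
  by apply: nc; exact: (regular_form_wedge HD).
congr (symbol_deriv D _ _ x); apply: funext => y.
rewrite (d_exp_form_wedge HD) //; last by move=> z; rewrite (dN HD) // closed_b oppr0.
(* the quadratic term of the exponential has degree 5 here *)
have h5 : wedge (- b y) (wedge (- b y) (df y)) = 0.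
  apply: (@homogeneous_gt _ _ 5) => //.
  exact: (homogeneous_wedge (hNb y) (homogeneous_wedge (hNb y) (h1 y))).
rewrite /exp_form !(wedgeDl, wedgeZl) wedgeA h5 scaler0 addr0 wedge1l contrD.
by rewrite contr_homogeneous1 // add0r wedgeNl linearN.
Qed.

End ClosedTwoForm.

End SymplecticDerivative.

(** * Smooth functions and the Poincare lemma *)

From mathcomp Require Import complex.
From mathcomp Require Import all_classical all_reals all_analysis.
Import numFieldNormedType.Exports.

Section Lines.
Local Open Scope classical_set_scope.
Variables (R : realType) (V : normedModType R).
Implicit Types (h : V -> R) (x v : V).

Lemma is_derive_line h x v (s : R) : derivable h (x + s *: v) v ->
  is_derive s 1 (fun t : R => h (x + t *: v)) ('D_v h (x + s *: v)).
Proof.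
move=> dh.
have E : (fun u : R => u^-1 *: (h (x + (u *: 1 + s) *: v) - h (x + s *: v)))
   = (fun u : R => u^-1 *: (h (u *: v + (x + s *: v)) - h (x + s *: v))).
  by apply/funext => u; congr (_ *: (h _ - _)); rewrite scalerDl -scalerA scale1r addrCA.
apply: DeriveDef; first by rewrite /derivable /= E.
by rewrite /derive /= E.
Qed.

Lemma is_derive_line_scaled h x v (r s : R) :
  derivable h (x + (s * r) *: v) v ->
  is_derive s 1 (fun t : R => h (x + (t * r) *: v))
    (r * 'D_v h (x + (s * r) *: v)).
Proof.
move=> /is_derive_line dh.
have dr : is_derive s 1 ( *%R^~ r : R -> R) r.
  have H := @is_deriveM _ _ (@id R) (cst r) s 1 _ _ (is_derive_id _ _) (is_derive_cst _ _ _).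
  have -> : *%R^~ r = (@id R) * cst r :> (R -> R) by [].
  by apply: (is_derive_eq H); rewrite scaler0 add0r /GRing.scale /= mulr1.
rewrite mulrC.
exact: (@is_derive1_comp R (fun t => h (x + t *: v)) ( *%R^~ r) s _ _ dh dr).
Qed.

Lemma mean_value_line h x v (r : R) : (forall y, derivable h y v) ->
  exists2 t : R, 0 <= t <= 1 &
    h (x + r *: v) - h x = r * 'D_v h (x + (t * r) *: v).
Proof.
move=> dh.
have D (s : R) := @is_derive_line_scaled h x v r s (dh _).
have := @MVT_segment R _ _ 0 1 ler01 (fun s _ => D s).
case=> [|t t01].
  by apply: derivable_within_continuous => s _; have [] := D s.
rewrite !mul1r mul0r scale0r addr0 subr0 mulr1 => ->.
by exists t.
Qed.

End Lines.

Section Directions.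
Local Open Scope classical_set_scope.
Variables (R : realType) (V : normedModType R).
Implicit Types (h : V -> R) (x u v : V).

(** The form in which continuity at x is used: the coefficients a and b are
    supplied by mean value theorems, so nothing is known about them. *)
Lemma near_corner x u v (P : set V) : nbhs x P ->
  \forall t \near (0 : R), forall a b : R, 0 <= a <= 1 -> 0 <= b <= 1 ->
    P (x + (a * t) *: u + (b * t) *: v).
Proof.
move=> /nbhs_ballP[d /= d0 dP].
have K : 0 < `|u| + `|v| + 1 by rewrite ltr_wpDl // addr_ge0.
near=> t => a b /andP[a0 a1] /andP[b0 b1]; apply: dP.
rewrite -ball_normE /= -addrA opprD addNKr normrN.
have td : `|t| * (`|u| + `|v| + 1) < d.
  rewrite -ltr_pdivlMr //; near: t.
  by apply: (@nbhs0_lt R R^o); rewrite divr_gt0.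
apply: le_lt_trans td.
apply: (le_trans (ler_normD _ _)); rewrite !normrZ.
rewrite (ger0_norm a0) (ger0_norm b0).
rewrite !mulrDr mulr1 -[leLHS]addr0; apply: lerD => //.
by apply: lerD; apply: ler_wpM2r => //; rewrite ler_piMl.
Unshelve. all: by end_near. Qed.

(** Directional derivatives are additive as soon as one of them is continuous: the
    increment along u is taken at x + t v and evaluated by the mean value theorem.
    This leads to the chain rule along lines without total differentiability. *)
Lemma is_derive_addv h x u v :
    (forall y, derivable h y u) -> {for x, continuous ('D_u h)} ->
    derivable h x v ->
  is_derive x (u + v) h ('D_u h x + 'D_v h x).
Proof.
move=> du cu dv.
suff H : (fun t : R => t^-1 *: (h (t *: (u + v) + x) - h x)) @ 0^'
    --> 'D_u h x + 'D_v h x.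
  apply: DeriveDef; first by apply/cvg_ex; exists ('D_u h x + 'D_v h x).
  exact: cvg_lim.
have -> : (fun t : R => t^-1 *: (h (t *: (u + v) + x) - h x)) =
    (fun t => t^-1 *: (h (x + t *: v + t *: u) - h (x + t *: v))) \+
    (fun t => t^-1 *: (h (t *: v + x) - h x)).
  apply/funext => t /=; rewrite -scalerDr; congr (_ *: _).
  rewrite [t *: v + x]addrC subrKA; congr (h _ - _).
  by rewrite scalerDr addrC [t *: u + _]addrC addrA.
suff cu' : (fun t : R => t^-1 *: (h (x + t *: v + t *: u) - h (x + t *: v))) @ 0^'
    --> 'D_u h x.
  exact: (@cvgD _ _ _ _ _ _ _ _ _ cu' dv).
apply/cvgrPdist_lt => e e0.
move/cvgrPdist_lt: cu => /(_ e e0) /(near_corner v u) cu.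
near=> t.
have t0 : t != 0 by near: t; exact: nbhs_dnbhs_neq.
have [c c01 ->] := mean_value_line (x + t *: v) t du.
rewrite scalerA mulVf // scale1r.
rewrite -[X in x + X *: v]mul1r.
suff H : forall a b : R, 0 <= a <= 1 -> 0 <= b <= 1 ->
    `|'D_u h x - 'D_u h (x + (a * t) *: v + (b * t) *: u)| < e.
  by apply: H => //; rewrite ler01 lexx.
near: t; exact: cvg_within.
Unshelve. all: by end_near. Qed.

(** The mean value theorem along u, then along v. *)
Lemma second_difference h x u v (t : R) :
    (forall y, derivable h y u) -> (forall y, derivable ('D_u h) y v) ->
  exists a b : R, [/\ 0 <= a <= 1, 0 <= b <= 1 &
    h (x + t *: u + t *: v) - h (x + t *: u) - h (x + t *: v) + h x
      = t * (t * 'D_v ('D_u h) (x + (a * t) *: u + (b * t) *: v))].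
Proof.
move=> du duv.
pose g y := h (y + t *: v) - h y.
have dg y : is_derive y u g ('D_u h (y + t *: v) - 'D_u h y).
  apply: is_deriveB; last exact: derivableP.
  have E : (fun s : R => s^-1 *: (h (s *: u + y + t *: v) - h (y + t *: v)))
   = (fun s : R => s^-1 *: (h (s *: u + (y + t *: v)) - h (y + t *: v))).
    by apply/funext => s; rewrite addrA.
  by apply: DeriveDef; rewrite /derivable /derive /= E //; exact: du.
have [|a a01 Ea] := @mean_value_line R V g x u t; first by move=> y; have [] := dg y.
have [b b01 Eb] := mean_value_line (x + (a * t) *: u) t duv.
exists a, b; split => //.
rewrite -Eb.
have [_ <-] := dg (x + (a * t) *: u); rewrite -Ea /g.
by rewrite opprB !addrA addrAC.
Qed.

(** Schwarz's theorem: the second difference is symmetric in u and v, hence t^2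
    times either mixed derivative, each at some point close to x. *)
Lemma derive_comm h x u v :
    (forall y, derivable h y u) -> (forall y, derivable h y v) ->
    (forall y, derivable ('D_u h) y v) -> (forall y, derivable ('D_v h) y u) ->
    {for x, continuous ('D_v ('D_u h))} -> {for x, continuous ('D_u ('D_v h))} ->
  'D_v ('D_u h) x = 'D_u ('D_v h) x.
Proof.
move=> du dv duv dvu cuv cvu.
move/cvgrPdist_lt: cuv; move/cvgrPdist_lt: cvu.
move: ('D_v ('D_u h) x) ('D_u ('D_v h) x) => p q cvu cuv.
apply/eqP; rewrite -subr_eq0 -normr_eq0; apply/negPn/negP => N0.
have e0 : 0 < `|p - q| / 2 by rewrite divr_gt0 // lt_def N0 /=.
move: cuv => /(_ _ e0) /(near_corner u v) /cvg_within cuv.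
move: cvu => /(_ _ e0) /(near_corner v u) /cvg_within cvu.

have t_neq0 : \forall t \near (0 : R)^', t != 0 by exact: nbhs_dnbhs_neq.
have [t [[t0 H1] H2]] := filter_ex (filterI (filterI t_neq0 (cuv _)) (cvu _)).
(* the same second difference, expanded in the two orders *)
have [a [b [a01 b01 E1]]] := second_difference x t du duv.
have [c [d [c01 d01 E2]]] := second_difference x t dv dvu.
move: E1; rewrite (addrAC x) (addrAC (h _)) E2 => /(mulfI t0) /(mulfI t0) E.
have {}H1 := H1 a b a01 b01.
have {}H2 := H2 c d c01 d01.
rewrite -E in H1.
have := ltrD H1 H2; rewrite -splitr.
set z := 'D_u _ _ in H2 *.
have := ler_distD z p q; rewrite (distrC z q) => /le_lt_trans H /H.
by rewrite ltxx.
Qed.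

End Directions.

Section Smooth.
Local Open Scope classical_set_scope.
Variables (R : realType) (n : nat).
Local Notation M := 'rV[R]_n.+1.
Implicit Types (h f g : M -> R) (x v : M) (i j : 'I_n.+1).

(** A coinduction principle. It is applied to classes stable under the partial
    derivatives, and spares an induction on iterated derivatives. *)
Lemma smooth_coind (P : (M -> R) -> Prop) :
    (forall h, P h -> continuous h /\
       forall i, (forall x, derivable h x (delta_mx 0 i)) /\ P (partial i h)) ->
  forall h, P h -> smooth h.
Proof.
move=> PP h Ph s.
have Ps : P (foldr (@partial R n) h s).
  by elim: s => //= i s /PP[_ /(_ i)[]].
by have [ch dh] := PP _ Ps; split => // i x; have [] := dh i.
Qed.

Lemma smooth_continuous h : smooth h -> continuous h.
Proof. by move=> /(_ [::])[]. Qed.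

Lemma smooth_derivable h i x : smooth h -> derivable h x (delta_mx 0 i).
Proof. by move=> /(_ [::])[_]; apply. Qed.

Lemma smooth_partial h i : smooth h -> smooth (partial i h).
Proof. by move=> sh s; have := sh (rcons s i); rewrite foldr_rcons. Qed.

Lemma partial_cst (c : R) i : partial i (fun _ : M => c) = fun=> 0.
Proof. by apply/funext => x; exact: derive_cst. Qed.

Lemma partialD f g i : smooth f -> smooth g ->
  partial i (fun x => f x + g x) = (fun x => partial i f x + partial i g x).
Proof.
move=> sf sg; apply/funext => x.
by rewrite /partial -(deriveD (@smooth_derivable _ i x sf) (@smooth_derivable _ i x sg)).
Qed.

Lemma partialM f g i : smooth f -> smooth g ->
  partial i (fun x => f x * g x) = (fun x => partial i f x * g x + f x * partial i g x).
Proof.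
move=> sf sg; apply/funext => x.
have := deriveM (@smooth_derivable _ i x sf) (@smooth_derivable _ i x sg).
by rewrite /partial /GRing.scale /= addrC [g x * _]mulrC => <-.
Qed.

Lemma smooth_cst (c : R) : smooth (fun _ : M => c).
Proof.
apply: (@smooth_coind (fun h => exists c, h = fun=> c)); last by exists c.
move=> _ [a ->]; split=> [x|i]; first exact: (@cst_continuous _ _ a x).
split=> [x|]; first exact: derivable_cst.
by exists 0; rewrite partial_cst.
Qed.

(** The algebra generated by the smooth functions: it is stable under the
   partial derivatives by the Leibniz rule, hence consists of smooth functions. *)
Inductive smooth_algebra : (M -> R) -> Prop :=
| SmoothBase h of smooth h : smooth_algebra h
| SmoothAdd f g of smooth_algebra f & smooth_algebra g :
    smooth_algebra (fun x => f x + g x)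
| SmoothMul f g of smooth_algebra f & smooth_algebra g :
    smooth_algebra (fun x => f x * g x).

Lemma smooth_algebra_smooth h : smooth_algebra h -> smooth h.
Proof.
apply: smooth_coind => {}h; elim=> {h} [h sh|f g _ [cf df] _ [cg dg]|f g saf [cf df] sag [cg dg]].
- split; first exact: smooth_continuous.
  move=> i; split => [x|]; first exact: smooth_derivable.
  exact/SmoothBase/smooth_partial.
- split=> [x|i]; first exact: (cvgD (cf x) (cg x)).
  have [dfi sfi] := df i; have [dgi sgi] := dg i.
  split=> [x|]; first exact: (derivableD (dfi x) (dgi x)).
  suff -> : partial i (fun x => f x + g x) = (fun x => partial i f x + partial i g x).
    exact: SmoothAdd.
  by apply/funext => x; rewrite /partial -(deriveD (dfi x) (dgi x)).
- split=> [x|i]; first exact: (cvgM (cf x) (cg x)).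
  have [dfi sfi] := df i; have [dgi sgi] := dg i.
  split=> [x|]; first exact: (derivableM (dfi x) (dgi x)).
  suff -> : partial i (fun x => f x * g x) = (fun x => partial i f x * g x + f x * partial i g x).
    by apply: SmoothAdd; apply: SmoothMul.
  apply/funext => x; have := deriveM (dfi x) (dgi x).
  by rewrite /partial /GRing.scale /= addrC [g x * _]mulrC => <-.
Qed.

Lemma smoothD f g : smooth f -> smooth g -> smooth (fun x => f x + g x).
Proof. by move=> sf sg; apply/smooth_algebra_smooth/SmoothAdd; apply: SmoothBase. Qed.

Lemma smoothM f g : smooth f -> smooth g -> smooth (fun x => f x * g x).
Proof. by move=> sf sg; apply/smooth_algebra_smooth/SmoothMul; apply: SmoothBase. Qed.

Lemma partial_comm h i j : smooth h ->
  partial i (partial j h) = partial j (partial i h).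
Proof.
move=> sh; apply/funext => x; apply: derive_comm.
- by move=> y; apply: smooth_derivable.
- by move=> y; apply: smooth_derivable.
- by move=> y; apply/smooth_derivable/smooth_partial.
- by move=> y; apply/smooth_derivable/smooth_partial.
- by apply: smooth_continuous; do 2!apply: smooth_partial.
- by apply: smooth_continuous; do 2!apply: smooth_partial.
Qed.

Lemma is_derive_coord i x v : is_derive x v (fun y : M => y 0 i) (v 0 i).
Proof.
suff H : (fun t : R => t^-1 *: ((t *: v + x) 0 i - x 0 i)) @ 0^' --> v 0 i.
  by apply: DeriveDef; [apply/cvg_ex; exists (v 0 i)|exact: cvg_lim].
apply: cvg_near_cst.
near=> t; rewrite !mxE addrK /GRing.scale /= mulKf //.
by near: t; exact: nbhs_dnbhs_neq.
Unshelve. all: by end_near. Qed.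

Lemma smooth_coord i : smooth (fun x : M => x 0 i).
Proof.
apply: (@smooth_coind (fun h => smooth h \/ h = fun x => x 0 i)); last by right.
move=> h [sh|->].
  split; first exact: smooth_continuous.
  by move=> j; split => [x|]; [exact: smooth_derivable|left; exact: smooth_partial].
split=> [x|j]; first exact: coord_continuous.
split=> [x|]; first by have [] := is_derive_coord i x (delta_mx 0 j).
left; suff -> : partial j (fun x => x 0 i) = fun=> (delta_mx 0 j : M) 0 i by exact: smooth_cst.
by apply/funext => x; have [] := is_derive_coord i x (delta_mx 0 j).
Qed.

Lemma partial_coord i j : partial i (fun x : M => x 0 j) = fun=> (i == j)%:R.
Proof.
apply/funext => x; have [_ E] := is_derive_coord j x (delta_mx 0 i).
by rewrite /partial E mxE eqxx /= eq_sym.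
Qed.

Lemma is_derive_scalev h x v (r : R) : derivable h x v ->
  is_derive x (r *: v) h (r * 'D_v h x).
Proof.
move=> dh.
have H : is_derive (0 : R) 1 (fun t : R => h (x + (t * r) *: v)) (r * 'D_v h x).
  by have := @is_derive_line_scaled R _ h x v r 0; rewrite mul0r scale0r addr0 => /(_ dh).
have E : (fun u : R => u^-1 *: (h (x + ((u *: 1 + 0) * r) *: v) - h (x + ((0 : R) * r) *: v)))
   = (fun u : R => u^-1 *: (h (u *: (r *: v) + x) - h x)).
  apply/funext => u; congr (_ *: (h _ - h _)); last by rewrite mul0r scale0r addr0.
  by rewrite addr0 scalerA addrC /GRing.scale /= mulr1.
have [d e] := H.
by apply: DeriveDef; [rewrite /derivable -E|rewrite -e /derive E].
Qed.

(** The directions v_i e_i are added up one at a time by is_derive_addv. *)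
Lemma smooth_is_derive h x v : smooth h ->
  is_derive x v h (\sum_i v 0 i * partial i h x).
Proof.
move=> sh; rewrite {1}(row_sum_delta v).
have D i y := is_derive_scalev (v 0 i) (@smooth_derivable _ i y sh).
elim: (index_enum _) => [|i s IH]; first by rewrite !big_nil; exact: is_derive0.
rewrite !big_cons; have [dw <-] := IH.
have [_ <-] := D i x.
have du y : derivable h y (v 0 i *: delta_mx 0 i) by have [] := D i y.
suff cu : {for x, continuous ('D_(v 0 i *: delta_mx 0 i) h)}.
  exact: (is_derive_addv du cu dw).
have -> : 'D_(v 0 i *: delta_mx 0 i) h = (fun y => v 0 i * partial i h y).
  by apply/funext => y; have [_] := D i y.
exact/smooth_continuous/smoothM/smooth_partial/sh/smooth_cst.
Qed.

Lemma is_derive_ray h x (s : R) : smooth h ->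
  is_derive s 1 (fun t : R => h (t *: x)) (\sum_i x 0 i * partial i h (s *: x)).
Proof.
move=> sh; have [dh <-] := smooth_is_derive (s *: x) x sh.
have := @is_derive_line R _ h 0 x s; rewrite add0r => /(_ dh).
by under eq_fun do rewrite add0r.
Qed.

End Smooth.

Section RayMean.
Local Open Scope classical_set_scope.
Variables (R : realType) (n : nat).
Local Notation M := 'rV[R]_n.+1.
Local Notation mu := (@lebesgue_measure R).
Implicit Types (h f g : M -> R) (x v : M) (i j : 'I_n.+1) (m : nat).

Lemma smooth_bounded h (r : R) : smooth h ->
  exists K : R, forall x, `|x| <= r -> `|h x| <= K.
Proof.
move=> /smooth_continuous ch.
have cB : compact [set x : M | `|x| <= r].
  apply: bounded_closed_compact.
    by exists r; split=> [|k rk x /= xr]; [exact: num_real|exact: le_trans xr (ltW rk)].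
  apply: (@closed_comp _ _ (fun x : M => `|x|) [set t : R | t <= r]).
    by move=> x _; exact: norm_continuous.
  exact: closed_le.
have : compact (h @` [set x : M | `|x| <= r]).
  by apply: continuous_compact => //; exact: continuous_subspaceT.
move=> /compact_bounded[K [_ HK]]; exists (K + 1) => x xr.
by apply: (HK (K + 1)); [rewrite ltrDl|exists x].
Qed.

Lemma continuous_ray m h x : smooth h ->
  continuous (fun t : R => t ^+ m * h (t *: x)).
Proof.
move=> /smooth_continuous ch t; apply: cvgM; first exact: exprn_continuous.
apply: (@continuous_comp _ _ _ (fun t : R => t *: x) h); last exact: ch.
exact: scalel_continuous.
Qed.

Lemma integrable_ray m h x : smooth h ->
  mu.-integrable `[0, 1] (EFin \o (fun t : R => t ^+ m * h (t *: x))).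
Proof.
move=> sh; apply: continuous_compact_integrable; first exact: segment_compact.
by apply: continuous_subspaceT; exact: continuous_ray.
Qed.

(** The weight m is needed since each derivative of ray_mean m h brings out one
    more factor t (partial_ray_mean). *)
Definition ray_mean m h x : R :=
  \int[mu]_(t in `[0, 1]) (t ^+ m * h (t *: x)).

Lemma ray_meanD m f g x : smooth f -> smooth g ->
  ray_mean m (fun y => f y + g y) x = ray_mean m f x + ray_mean m g x.
Proof.
move=> sf sg; rewrite /ray_mean -RintegralD //; first by under eq_Rintegral do rewrite mulrDr.
  exact: integrable_ray.
exact: integrable_ray.
Qed.

Lemma ray_meanZ m (c : R) h x : smooth h ->
  ray_mean m (fun y => c * h y) x = c * ray_mean m h x.
Proof.
move=> sh; rewrite /ray_mean -RintegralZl //; first by under eq_Rintegral do rewrite mulrCA.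
exact: integrable_ray.
Qed.

(** As [0, 1] is compact, h (t y) tends to h (t x) uniformly in t as y tends to x. *)
Lemma ray_mean_continuous m h : smooth h -> continuous (ray_mean m h).
Proof.
move=> sh x; apply/(@cvgrPdist_lt R R^o M (nbhs x) (nbhs_filter x)) => e e0.
have e2 : 0 < e / 2 by rewrite divr_gt0.
have ch := smooth_continuous sh.
have tube : \forall y \near x, forall t : R, `[0, 1]%classic t ->
    `|h (t *: x) - h (t *: y)| <= e / 2.
  have /compact_near_coveringP cov := @segment_compact R 0 1.
  apply: (cov M (nbhs x) (fun y t => `|h (t *: x) - h (t *: y)| <= e / 2) (nbhs_filter x)).
  move=> t _ /=.
  have e4 : 0 < e / 2 / 2 by rewrite divr_gt0.
  have H : \forall z \near (t *: x), `|h (t *: x) - h z| < e / 2 / 2.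
    by move/cvgrPdist_lt: (ch (t *: x)) => /(_ _ e4).
  have H1 : \forall s \near t & y \near x, `|h (t *: x) - h (s *: y)| < e / 2 / 2.
    exact: (@scale_continuous R M (t, x) _ H).
  have H2 : \forall s \near t & y \near x, `|h (t *: x) - h (s *: x)| < e / 2 / 2.
    have cs : (fun p : R * M => p.1 *: x) @ (t, x) --> t *: x.
      apply: (@cvgZr_tmp _ _ _ _ _ (@fst R M) t x); exact: cvg_fst.
    exact: (cs _ H).
  apply: filterS (filterI H1 H2) => -[s y] /= [a1 a2].
  rewrite (le_trans (ler_distD (h (t *: x)) _ _)) // (splitr (e / 2)) lerD //.
    by rewrite distrC ltW.
  exact: ltW.
apply: filterS tube => y Hy.
have I1 := integrable_ray m x sh; have I2 := integrable_ray m y sh.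
rewrite /ray_mean -RintegralB //.
apply: le_lt_trans (le_normr_Rintegral _ _) _ => //.
  exact: (integrableB _ I1 I2).
have e2e : e / 2 < e by rewrite ltr_pdivrMr // ltr_pMr // ltr1n.
apply: le_lt_trans e2e.
have I3 : mu.-integrable `[0, 1] (EFin \o (cst (e / 2) : R -> R)).
  apply: continuous_compact_integrable; first exact: segment_compact.
  by apply: continuous_subspaceT => ?; exact: cst_continuous.
have -> : e / 2 = \int[mu]_(t in `[0, 1]) (cst (e / 2) t).
  rewrite Rintegral_cst //; have := @lebesgue_measure_itv R `[0, 1]%R.
  by rewrite /= lte01 oppr0 adde0 => ->; rewrite mulr1.
apply: le_Rintegral => //.
-  by apply: integrable_norm; exact: (integrableB _ I1 I2).
- move=> t t01.
  rewrite -mulrBr normrM ger0_norm; last first.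
    by move: t01; rewrite /= in_itv /= => /andP[t0 _]; rewrite exprn_ge0.
  apply: le_trans (Hy t t01).
  move: t01; rewrite /= in_itv /= => /andP[t0 t1]; by rewrite ler_piMl // exprn_ile1.
Qed.

End RayMean.

Section RayMeanDerivatives.
Local Open Scope classical_set_scope.
Variables (R : realType) (n : nat).
Local Notation M := 'rV[R]_n.+1.
Local Notation mu := (@lebesgue_measure R).
Implicit Types (h f g : M -> R) (x v : M) (i j : 'I_n.+1) (m : nat).

(** Differentiation under the integral sign. The derivatives are dominated by a
    constant because the points t (x + s e_i) with |s| < 1 stay in a fixed ball. *)
Lemma is_derive_ray_mean m h i x : smooth h ->
  is_derive x (delta_mx 0 i) (ray_mean m h) (ray_mean m.+1 (partial i h) x).
Proof.
move=> sh; set v : M := delta_mx 0 i.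
pose F (s t : R) : R := t ^+ m * h (t *: x + (s * t) *: v).
have rayE (s t : R) : t *: x + (s * t) *: v = t *: (x + s *: v).
  by rewrite scalerDr scalerA mulrC.
have dF (s t : R) : is_derive s 1 (F^~ t) (t ^+ m.+1 * partial i h (t *: (x + s *: v))).
  have H := is_derive_line_scaled (@smooth_derivable R n h i (t *: x + (s * t) *: v) sh).
  have := is_deriveZ (t ^+ m) H.
  by rewrite rayE /GRing.scale /= mulrA -exprSr.
have [K HK] := smooth_bounded (`|x| + `|v|) (smooth_partial i sh).
have in01 (t : R) : `[0, 1]%classic t -> 0 <= t <= 1 by rewrite /= in_itv.
have D := @cvg_differentiation_under_integral R _ _ mu F `[0, 1]%classic
  (measurable_itv _) 0 (-1) 1.
have {}D : (fun s : R => s^-1 *: (ray_mean m h (s *: v + x) - ray_mean m h x)) @ 0^'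
    --> ray_mean m.+1 (partial i h) x.
  have -> : ray_mean m.+1 (partial i h) x =
      \int[mu]_(t in `[0, 1]) (partial1of2 F ^~ t) 0.
    apply: eq_Rintegral => t _; rewrite /partial1of2 derive1E.
    by have [_ ->] := dF 0 t; rewrite scale0r addr0.
  have E (s : R) : ray_mean m h (s *: v + x) = \int[mu]_(t in `[0, 1]) F (s + 0) t.
    by apply: eq_Rintegral => t _; rewrite /F rayE addr0 addrC.
  have E0 : ray_mean m h x = \int[mu]_(t in `[0, 1]) F 0 t.
    by apply: eq_Rintegral => t _; rewrite /F mul0r scale0r addr0.
  under eq_fun do rewrite E E0.
  apply: (D _ _ _ (fun=> `|K|)).
  - by rewrite /= in_itv /= ltrN10 ltr01.
  - move=> s _.
    have -> : F s = (fun t : R => t ^+ m * h (t *: (x + s *: v))).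
      by apply/funext => t; rewrite /F rayE.
    exact: integrable_ray.
  - by move=> s t _ _; have [] := dF s t.
  - by move=> _; exact: normr_ge0.
  - apply: continuous_compact_integrable; first exact: segment_compact.
    by apply: continuous_subspaceT => ?; exact: cst_continuous.
  move=> s t; rewrite /= in_itv /= => /andP[s0 s1] /in01/andP[t0 t1].
  rewrite /partial1of2 derive1E; have [_ ->] := dF s t.
  rewrite normrM normrX (ger0_norm t0) -[leRHS]mul1r.
  apply: ler_pM => //; [exact: exprn_ge0|by rewrite exprn_ile1|].
  apply: le_trans (ler_norm _); apply: HK; rewrite normrZ (ger0_norm t0).
  rewrite -[leRHS]mul1r ler_pM // (le_trans (ler_normD _ _)) // lerD2l normrZ.
  by rewrite ler_piMl // ler_norml (ltW s0) (ltW s1).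
by apply: DeriveDef; [apply/cvg_ex; eexists; exact: D|exact: cvg_lim].
Qed.

Lemma partial_ray_mean m h i : smooth h ->
  partial i (ray_mean m h) = ray_mean m.+1 (partial i h).
Proof.
by move=> sh; apply/funext => x; have [_] := is_derive_ray_mean m i x sh.
Qed.

Lemma smooth_ray_mean m h : smooth h -> smooth (ray_mean m h).
Proof.
move=> sh.
apply: (@smooth_coind R n (fun g => exists m h, smooth h /\ g = ray_mean m h)); last by exists m, h.
move=> _ {m h sh} [m [h [sh ->]]]; split; first exact: ray_mean_continuous.
move=> i; split => [x|]; first by have [] := is_derive_ray_mean m i x sh.
exists m.+1, (partial i h); split; first exact: smooth_partial.
exact: partial_ray_mean.
Qed.

Lemma smooth_sum (I : Type) (s : seq I) (F : I -> M -> R) :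
  (forall k : I, smooth (F k)) -> smooth (fun x => \sum_(k <- s) F k x).
Proof.
move=> sF; elim: s => [|i s IH].
  have -> : (fun x => \sum_(k <- [::]) F k x) = fun=> 0.
    by apply/funext => x; rewrite big_nil.
  exact: smooth_cst.
have -> : (fun x => \sum_(k <- i :: s) F k x) = fun x => F i x + \sum_(k <- s) F k x.
  by apply/funext => x; rewrite big_cons.
exact: smoothD (sF i) IH.
Qed.

Lemma ray_mean_sum (I : Type) (s : seq I) m (F : I -> M -> R) x :
    (forall k : I, smooth (F k)) ->
  ray_mean m (fun y => \sum_(k <- s) F k y) x = \sum_(k <- s) ray_mean m (F k) x.
Proof.
move=> sF; elim: s => [|i s IH].
  rewrite big_nil /ray_mean; under eq_Rintegral do rewrite big_nil mulr0.
  by rewrite Rintegral_cst // mul0r.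
rewrite big_cons -IH -ray_meanD //; last exact: smooth_sum.
by congr (ray_mean m _ x); apply/funext => y; rewrite big_cons.
Qed.

(** The fundamental theorem of calculus for t^(m+1) h (t x) between 0 and 1. *)
Lemma ray_mean_euler m h x : smooth h ->
  m.+1%:R * ray_mean m h x + \sum_i x 0 i * ray_mean m.+1 (partial i h) x = h x.
Proof.
move=> sh.
pose F (t : R) := t ^+ m.+1 * h (t *: x).
pose g y := \sum_i x 0 i * partial i h y.
have sp i : smooth (fun y => x 0 i * partial i h y).
  by apply: smoothM; [exact: smooth_cst|exact: smooth_partial].
have sg : smooth g by exact: smooth_sum.
have dF (t : R) : is_derive t 1 F (t ^+ m * (m.+1%:R * h (t *: x)) + t ^+ m.+1 * g (t *: x)).
  have H1 := is_derive_ray x t sh.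
  have H2 := @is_deriveX R R id m.+1 t 1 1 (is_derive_id _ _).
  have -> : F = (id : R -> R) ^+ m.+1 * (fun t : R => h (t *: x)).
    by apply/funext => s; rewrite /F !fctE.
  have H3 := is_deriveM H2 H1.
  apply: (is_derive_eq H3); rewrite !fctE /GRing.scale /= addrC mulr1; congr (_ + _).
  by rewrite mulrC [in RHS]mulrCA mulrA.
have cdF : continuous (fun t : R => t ^+ m * (m.+1%:R * h (t *: x)) + t ^+ m.+1 * g (t *: x)).
  move=> t; apply: cvgD; last exact: continuous_ray.
  apply: (@continuous_ray R n m (fun y => m.+1%:R * h y)).
  by apply: smoothM; first exact: smooth_cst.
have cF : continuous F by exact: continuous_ray.
have := @continuous_FTC2 R _ F 0 1 ltr01 (continuous_subspaceT cdF).
rewrite /F !scale1r expr0n expr1n mul0r mul1r sube0.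
have -> : \sum_i x 0 i * ray_mean m.+1 (partial i h) x = ray_mean m.+1 g x.
  rewrite ray_mean_sum //; apply: eq_bigr => i _.
  by rewrite ray_meanZ; last exact: smooth_partial.
have I1 := integrable_ray m x (smoothM (smooth_cst (m.+1%:R : R)) sh).
have I2 := integrable_ray m.+1 x sg.
rewrite -ray_meanZ // /ray_mean -(RintegralD _ I1 I2) //.
move=> H; rewrite /Rintegral H //.
- split => [t _||]; first by have [] := dF t.
    by apply: cvg_at_right_filter; exact: cF.
  by apply: cvg_at_left_filter; exact: cF.
- by move=> t _; rewrite derive1E; have [_] := dF t.
Qed.

End RayMeanDerivatives.

Section Poincare.
Local Open Scope classical_set_scope.
Variables (R : realType) (n : nat).
Local Notation M := 'rV[R]_n.+1.
Implicit Types (s t : M -> exterior R n.+1) (i j : 'I_n.+1) (m k : nat).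
Local Notation eps i := (wedge (ext_basis R [set i])).
Local Notation iota i := (interior_product (delta_mx 0 i)).

Lemma smooth_derivations : derivations (@smooth R n) (@partial R n).
Proof.
split.
- exact: smooth_cst.
- exact: smoothD.
- exact: smoothM.
- by move=> i f; exact: smooth_partial.
- by move=> i c; exact: partial_cst.
- by move=> i f g; exact: partialD.
- by move=> i f g; exact: partialM.
- by move=> i j f; exact: partial_comm.
Qed.
Local Notation HD := smooth_derivations.
Local Notation smooth_form := (regular_form (@smooth R n)).

Definition form_ray_mean m t (x : M) : exterior R n.+1 :=
  [ffun S : {set 'I_n.+1} => ray_mean m (fun y => t y S) x].

Lemma form_ray_mean_linear (A : exterior R n.+1 -> exterior R n.+1) m t x :
    linear A -> smooth_form t ->
  form_ray_mean m (fun y => A (t y)) x = A (form_ray_mean m t x).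
Proof.
move=> linA st; apply/ffunP => S; rewrite ffunE linear_coefE //.
have -> : (fun y => A (t y) S) = fun y => \sum_T A (ext_basis R T) S * t y T.
  by apply/funext => y; rewrite linear_coefE.
rewrite ray_mean_sum => [|T]; last by apply: smoothM; [exact: smooth_cst|exact: st].
by apply: eq_bigr => T _; rewrite ray_meanZ ?ffunE //; exact: st.
Qed.

Lemma form_ray_mean_sum (I : Type) (r : seq I) m (t : I -> M -> exterior R n.+1) x :
    (forall a : I, smooth_form (t a)) ->
  form_ray_mean m (fun y => \sum_(a <- r) t a y) x = \sum_(a <- r) form_ray_mean m (t a) x.
Proof.
move=> st; apply/ffunP => S; rewrite ffunE sum_ffunE.
have -> : (fun y => (\sum_(i <- r) t i y) S) = fun y => \sum_(i <- r) t i y S.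
  by apply/funext => y; rewrite sum_ffunE.
by rewrite ray_mean_sum => [|i]; [apply: eq_bigr => i _; rewrite ffunE|exact: st].
Qed.

Lemma smooth_form_ray_mean m t : smooth_form t -> smooth_form (form_ray_mean m t).
Proof.
move=> st S; have -> : (fun x => form_ray_mean m t x S) = ray_mean m (fun y => t y S).
  by apply/funext => x; rewrite ffunE.
exact/smooth_ray_mean/st.
Qed.

Lemma partial_form_ray_mean i m t x : smooth_form t ->
  form_partial (@partial R n) i (form_ray_mean m t) x =
  form_ray_mean m.+1 (form_partial (@partial R n) i t) x.
Proof.
move=> st; apply/ffunP => S; rewrite !ffunE.
have -> : (fun y => form_ray_mean m t y S) = ray_mean m (fun y => t y S).
  by apply/funext => y; rewrite ffunE.
rewrite partial_ray_mean //; congr (ray_mean _ _ x).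
by apply/funext => y; rewrite ffunE.
Qed.

Lemma form_ray_mean0 m x : form_ray_mean m (fun=> 0) x = 0.
Proof.
have := @form_ray_mean_sum unit [::] m (fun _ _ => 0) x (fun _ => regular_form0 HD).
rewrite [RHS]big_nil => H; rewrite -[RHS]H; congr (form_ray_mean _ _ x).
by apply/funext => y; rewrite big_nil.
Qed.

(** The homotopy operator sends t to the mean over rays, with weight k, of the
    contraction of t with the position vector. By the anticommutation relations
    and Euler's formula, d of the result is (k + 1) times the mean of t, plus the
    mean of the derivative of t along the ray, minus the contraction of the mean of
    dt. The last term vanishes, and ray_mean_euler adds up the others. *)
Theorem poincare k t : is_form k.+1 t -> (forall x, extd t x = 0) ->
  exists2 s, is_form k s & forall x, extd s x = t x.
Proof.
move=> [ht st] dt.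
pose m := form_ray_mean k t.
have sm : smooth_form m by exact: smooth_form_ray_mean.
have siota j : smooth_form (fun x => iota j (m x)).
  by apply: (regular_form_linear HD) => //; exact: interior_product_is_linear.
have sxiota j : smooth_form (fun x => x 0 j *: iota j (m x)).
  exact: (regular_form_scale HD (@smooth_coord R n j) (siota j)).
exists (fun x : M => \sum_j x 0 j *: iota j (m x)).
  split=> [x|].
    apply: homogeneous_sum => j _; apply/homogeneousZ/homogeneous_iota => S kS.
    rewrite ffunE; have -> : (fun y => t y S) = fun=> 0 by apply/funext => y; exact: ht.
    have := form_ray_mean0 k x.
    by move=> /ffunP/(_ S); rewrite !ffunE.
  by apply: (regular_form_sum HD) => j; exact: sxiota.
move=> x.
pose m1 i := form_ray_mean k.+1 (form_partial (@partial R n) i t) x.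
(* the mean of dt, which is the mean of zero *)
have dm1 : \sum_i eps i (m1 i) = 0.
  rewrite -[RHS](form_ray_mean0 k.+1 x).
  have -> : (fun=> 0) = (fun y => \sum_i eps i (form_partial (@partial R n) i t y)).
    by apply/funext => y; rewrite -[LHS](dt y).
  have sp i : smooth_form (form_partial (@partial R n) i t) := regular_form_partial HD i st.
  have se i : smooth_form (fun y => eps i (form_partial (@partial R n) i t y)) :=
    regular_form_linear HD (wedge_is_linear _) (sp i).
  rewrite form_ray_mean_sum; last exact: se.
  apply: eq_bigr => i _.
  by rewrite (form_ray_mean_linear k.+1 x (wedge_is_linear _) (sp i)).
(* Leibniz rule for the product of a coordinate and a mean *)
have E i : form_partial (@partial R n) i (fun x : M => \sum_j x 0 j *: iota j (m x)) x =
    iota i (m x) + \sum_j x 0 j *: iota j (m1 i).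
  rewrite (form_partial_sum HD); last exact: sxiota.
  under eq_bigr => j _.
    rewrite (form_partial_scale HD i x (@smooth_coord R n j) (siota j)) partial_coord.
    rewrite (form_partial_linear HD (@interior_product_is_linear R n.+1 (delta_mx 0 j)) i x sm).
    rewrite (partial_form_ray_mean i k x st).
    over.
  rewrite big_split /=; congr (_ + _).
  rewrite (bigD1 i) //= eqxx scale1r big1 ?addr0 // => j ji.
  by rewrite eq_sym (negPf ji) scale0r.
rewrite /extd /ext_deriv -/(form_partial _ _ _ _).
under eq_bigr => i _ do rewrite -[X in wedge _ X]/(form_partial (@partial R n) i _ x) E wedgeDr.
rewrite big_split /= (eps_iota_sum (k := k.+1)); last first.
  move=> S kS; rewrite ffunE; have -> : (fun y => t y S) = fun=> 0 by apply/funext => y; exact: ht.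
  have := form_ray_mean0 k x.
  by move=> /ffunP/(_ S); rewrite !ffunE.
have -> : \sum_i eps i (\sum_j x 0 j *: iota j (m1 i)) = \sum_j x 0 j *: m1 j.
  under eq_bigr do rewrite linear_sum /=.
  rewrite exchange_big; apply: eq_bigr => j _ /=.
  under eq_bigr => i _.
    rewrite wedgeZr (_ : eps i (iota j (m1 i)) =
      (j == i)%:R *: m1 i - iota j (eps i (m1 i))); last first.
      by rewrite iota_eps opprB addrC subrK.
    over.
  rewrite -scaler_sumr sumrB -linear_sum /= dm1 interior_product0 subr0; congr (_ *: _).
  rewrite (bigD1 j) //= eqxx scale1r big1 ?addr0 // => i ij.
  by rewrite eq_sym (negPf ij) scale0r.
apply/ffunP => S; rewrite ext_addE ext_scaleE sum_ffunE -[RHS](ray_mean_euler k x (st S)).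
rewrite /m ffunE; congr (_ + _); apply: eq_bigr => j _; rewrite ext_scaleE ffunE.
by congr (_ * ray_mean _ _ x); apply/funext => y; rewrite ffunE.
Qed.

End Poincare.

(** * The decomposition into the U_k *)

Section Eigenbundles.
Variable R : realType.
Local Notation C := R[i].
Local Notation V4 := ('rV[C]_4 * 'rV[C]_4)%type.
Variables (omega : 'rV[R]_4 -> exterior R 4) (x : 'rV[R]_4).
Hypothesis omega2 : homogeneous 2 (omega x).
Implicit Types (e : V4) (a v : exterior C 4) (X : 'rV[C]_4) (k : nat).

Local Notation b := (Theta omega x).
Local Notation conj_ext := (@map_ext C C conjc 4).

(** The ratio of Theta - conj Theta to Omega (Theta_conj). *)
Definition neg2i : C := - 2 * 'i%C.

Lemma neg2i_neq0 : neg2i != 0.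
Proof. by rewrite /neg2i mulf_neq0 ?oppr_eq0 ?pnatr_eq0 // neq0Ci. Qed.

Lemma Theta_homogeneous : homogeneous 2 b.
Proof.
apply: homogeneousD; first exact: (@homogeneous_map_ext _ _ (real_complex R)).
rewrite -scaleN1r; do 2!apply: homogeneousZ.
apply: (@homogeneous_map_ext _ _ (real_complex R)); exact: homogeneous_symp.
Qed.

Lemma complexify_Omega : complexify (Omega R) = symp C.
Proof.
rewrite -[complexify _]/(map_ext (real_complex R) _) /Omega.
by rewrite map_extD !map_ext_wedge !map_ext_basis.
Qed.

Lemma Theta_conj : b - conj_ext b = neg2i *: symp C.
Proof.
have conj_i : conjc ('i%C : C) = - 'i%C.
  by apply/eqP; rewrite eq_complex /= oppr0 !eqxx.
have conj_symp : conj_ext (symp C) = symp C.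
  by rewrite /symp map_extD !map_ext_wedge !map_ext_basis.
have conj_real : conj_ext (complexify (omega x)) = complexify (omega x).
  by apply/ffunP => S; rewrite !ffunE; exact: conjc_real.
have conj_isymp : conj_ext ('i%C *: symp C) = - 'i%C *: symp C.
  by rewrite map_extZ conj_symp; congr (_ *: _); exact: conj_i.
rewrite /Theta complexify_Omega map_extD map_extN conj_isymp conj_real.
by apply/ffunP => S; rewrite /neg2i !(ext_addE, ext_scaleE, ext_oppE); ring.
Qed.

Lemma rho_exp_form_one (b' : exterior C 4) e : homogeneous 2 b' ->
  rho e (exp_form b') = wedge (exp_form b') (covector e.2 + interior_product e.1 b').
Proof.
move=> hb'; rewrite -[in LHS](wedge1r (exp_form b')) rho_exp_form // /rho !wedge1r.
by rewrite interior_productE big1 ?add0r // => i _; rewrite iota_one scaler0.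
Qed.

(** exp b' is invertible, hence a form multiple of it vanishes only if the factor
    does. *)
Lemma mem_lker_rho_exp_form (b' : exterior C 4) e : homogeneous 2 b' ->
  (e \in lker (linfun (rho_on (exp_form b')))) = (covector e.2 + interior_product e.1 b' == 0).
Proof.
move=> hb'; rewrite memv_ker lfunE /= /rho_on rho_exp_form_one //.
exact: (exp_form_wedge_inj (isT : (4 <= 5)%N) _ hb').
Qed.

Lemma mem_E e : (e \in E omega x) = (covector e.2 + interior_product e.1 b == 0).
Proof. exact: (mem_lker_rho_exp_form e Theta_homogeneous). Qed.

(** Conjugation carries the annihilator of exp Theta to that of exp (conj Theta).
    It is semilinear and involutive, so expanding the conjugate of e in the basis
    of E shows that e is in the span of the conjugates of that basis. *)
Lemma mem_Ebar e :
  (e \in Ebar omega x) = (covector e.2 + interior_product e.1 (conj_ext b) == 0).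
Proof.
have hc := homogeneous_map_ext conjc Theta_homogeneous.
have conjE e' : (conj_gvect e' \in lker (linfun (rho_on (exp_form (conj_ext b))))) =
    (e' \in E omega x).
  rewrite mem_lker_rho_exp_form // mem_E /= -map_ext_interior -map_ext_covector -map_extD.
  apply/eqP/eqP => [|->]; last exact: map_ext0.
  move/ffunP => H; apply/ffunP => S; have := H S; rewrite !ffunE => /eqP.
  by rewrite conjc_eq0 => /eqP.
have conj2 e' : conj_gvect (conj_gvect e') = e'.
  by case: e' => X xi; congr (_, _); apply/rowP => i; rewrite !mxE conjcK.
rewrite -mem_lker_rho_exp_form //; apply/idP/idP.
  move: e; apply/subvP; apply/span_subvP => _ /mapP[e eE ->].
  by rewrite conjE; exact: vbasis_mem eE.
rewrite -{1}(conj2 e) conjE => eE; rewrite -(conj2 e) (coord_vbasis eE).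
have conj_sum (I : Type) (r : seq I) (f : I -> V4) :
    conj_gvect (\sum_(i <- r) f i) = \sum_(i <- r) conj_gvect (f i).
  elim: r => [|i r IH]; rewrite ?big_nil ?big_cons.
    by congr (_, _); apply/rowP => i; rewrite !mxE conjc0.
  by rewrite -IH; congr (_, _); apply/rowP => j; rewrite !mxE rmorphD.
rewrite conj_sum rpred_sum // => i _.
have -> : conj_gvect (coord (vbasis (E omega x)) i (conj_gvect e) *: (vbasis (E omega x))`_i) =
   conjc (coord (vbasis (E omega x)) i (conj_gvect e)) *: conj_gvect (vbasis (E omega x))`_i.
  by congr (_, _); apply/rowP => j; rewrite !mxE rmorphM.
by apply/rpredZ/memv_span/map_f/mem_nth; rewrite size_tuple.
Qed.

Lemma rho_Ebar e a : e \in Ebar omega x ->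
  rho e (frame b (- neg2i^-1) a) = \sum_i (e.1 0 i * (neg2i * conjugate_sign C i)) *:
     frame b (- neg2i^-1) (wedge (ext_basis C [set conjugate_index i]) a).
Proof.
rewrite mem_Ebar => /eqP eE.
exact: (rho_frame a Theta_homogeneous neg2i_neq0 Theta_conj eE).
Qed.

(** The covector is minus i_X (conj Theta), read off from its coefficients. *)
Lemma exists_Ebar X : exists2 e, e \in Ebar omega x & e.1 = X.
Proof.
exists (X, - \row_i interior_product X (conj_ext b) [set i]) => //.
rewrite mem_Ebar /= [X in _ + X]homogeneous1_covector; last first.
  rewrite interior_productE; apply: homogeneous_sum => i _; apply/homogeneousZ/homogeneous_iota.
  exact: (homogeneous_map_ext _ Theta_homogeneous).
rewrite /covector -big_split big1 // => i _ /=.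
by rewrite !mxE scaleNr addNr.
Qed.

End Eigenbundles.

Section Weights.
Variable R : realType.
Local Notation C := R[i].
Local Notation V4 := ('rV[C]_4 * 'rV[C]_4)%type.
Variables (omega : 'rV[R]_4 -> exterior R 4) (x : 'rV[R]_4).
Hypothesis omega2 : homogeneous 2 (omega x).
Implicit Types (e : V4) (a v : exterior C 4) (X : 'rV[C]_4) (k m : nat).

Local Notation b := (Theta omega x).
Local Notation G := (frame b (- (neg2i R)^-1)).
Local Notation G' := (unframe b (- (neg2i R)^-1)).
Local Notation Eb := (Ebar omega x).

Lemma memv_big_seq (K : fieldType) (vT : vectType K) (T : eqType) (s : seq T)
    (f : T -> {vspace vT}) (i : T) (v : vT) :
  i \in s -> v \in f i -> v \in (\sum_(j <- s) f j)%VS.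
Proof.
elim: s => // j s IH; rewrite inE big_cons => /orP[/eqP->|/IH {}IH] vf.
  by rewrite (subvP (addvSl _ _)).
by rewrite (subvP (addvSr _ _)) // IH.
Qed.

(** By Euler's formula a combines the products e_i /\ (i_i a), and the
    multiplication by each e_i is realized by an element of Ebar. *)
Lemma frame_homogeneous_cliffordv m a :
  homogeneous m a -> G a \in cliffordv Eb m (Phi omega x).
Proof.
elim: m a => [|m IH] a ha.
  rewrite (homogeneous0_one ha) linearZ /= frame_one; exact/rpredZ/memv_line.
have m0 : (m.+1%:R : C) != 0 by rewrite pnatr_eq0.
(* the multiples by m + 1 come from Euler's formula *)
rewrite -[a]scale1r -(mulVf m0) -scalerA -(eps_iota_sum ha) linearZ /= linear_sum /=.
apply/rpredZ/rpred_sum => i _.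
set c := interior_product _ a.
have hc : homogeneous m c by exact: homogeneous_iota.
(* i_X Omega is a multiple of e_i for X dual to the conjugate coordinate *)
have [e eE e1] := exists_Ebar omega2 (delta_mx 0 (conjugate_index i)).
have := rho_Ebar omega2 c eE.
rewrite e1 (bigD1 (conjugate_index i)) //= big1 ?addr0 => [|j /negPf ji]; last first.
  by rewrite mxE eqxx ji mul0r scale0r.
rewrite mxE !eqxx mul1r conjugate_indexK => E.
have t0 : neg2i R * conjugate_sign C (conjugate_index i) != 0.
  by rewrite mulf_neq0 ?neg2i_neq0 ?conjugate_sign_neq0.
rewrite -[frame _ _ _]scale1r -(mulVf t0) -scalerA -E; apply: rpredZ.
rewrite (coord_vbasis eE) -/(rho_on (G c) _) linear_sum; apply: rpred_sum => l _.
rewrite linearZ; apply: rpredZ => /=.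
apply: (memv_big_seq (i := (vbasis Eb)`_l)); first by rewrite mem_nth // size_tuple.
apply/memv_imgP; exists (G c); first exact: IH.
by rewrite lfunE.
Qed.

(** Elements of Ebar act in the frame by multiplication with covectors, which
    raises the degree by one. *)
Lemma cliffordv_frame m v : v \in cliffordv Eb m (Phi omega x) ->
  exists2 a, homogeneous m a & v = G a.
Proof.
elim: m v => [|m IH] v /=.
  move=> /vlineP[k ->]; exists (k *: ext_basis C finset.set0).
    exact/homogeneousZ/homogeneous_one.
  by rewrite linearZ /= frame_one.
set s := (vbasis Eb : seq V4).
have : {subset s <= Eb} by move=> e; exact: vbasis_mem.
elim: s v => [|e s IHs] v sE.
  rewrite big_nil memv0 => /eqP ->; exists 0; first exact: homogeneous0.
  by rewrite linear0.
rewrite big_cons => /memv_addP[_ /memv_imgP[w wW ->] [v2 v2s ->]].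
have [a2 ha2 ->] : exists2 a, homogeneous m.+1 a & v2 = G a.
  by apply: IHs => // e' e's; apply: sE; rewrite inE e's orbT.
have [a ha ->] := IH _ wW.
rewrite lfunE /= rho_Ebar //; last by apply: sE; rewrite inE eqxx.
exists (\sum_i (e.1 0 i * (neg2i R * conjugate_sign C i)) *:
  wedge (ext_basis C [set conjugate_index i]) a + a2).
  by apply: homogeneousD => //; apply: homogeneous_sum => i _; exact/homogeneousZ/homogeneous_eps.
rewrite linearD linear_sum; congr (_ + _); apply: eq_bigr => i _.
by rewrite linearZ.
Qed.

Lemma mem_U (k : int) v : (`|k| <= 2)%N ->
  v \in U omega k x <-> exists2 a, homogeneous `|2 - k|%N a & v = G a.
Proof.
move=> k2; rewrite /U k2; split; first exact: cliffordv_frame.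
by case=> a ha ->; exact: frame_homogeneous_cliffordv.
Qed.

Lemma weight_le2 (j : 'I_5) : (`|weight j| <= 2)%N.
Proof. by case: j => [[|[|[|[|[|//]]]]] lt]. Qed.

Lemma weight_degree (j : 'I_5) : `|2 - weight j|%N = (4 - j)%N.
Proof. by case: j => [[|[|[|[|[|//]]]]] lt]. Qed.

Lemma pi_out (k : int) t : (2 < `|k|)%N -> pi_ omega k t x = 0.
Proof.
move=> k2; rewrite /pi_ /U leqNgt k2 /=; apply/eqP; rewrite -memv0; exact: memv_pi.
Qed.

(** The forms whose frame components have degree 4 - j make up U_k for k = j - 2,
    and the sum of the other U_k consists of those with no component of that
    degree, so that the two spaces are complementary. *)
Lemma pi_weight (j : 'I_5) t :
  pi_ omega (weight j) t x = G (degree_part (4 - j) (G' (t x))).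
Proof.
rewrite /pi_; set V := (\sum_(_ | _) _)%VS; set W := U _ _ _; set v := t x.
have GK a : G' (G a) = a by exact/frameK/Theta_homogeneous.
have G'K a : G (G' a) = a by exact/unframeK/Theta_homogeneous.
have memW u : u \in W <-> exists2 a, homogeneous (4 - j) a & u = G a.
  by rewrite -weight_degree; exact/mem_U/weight_le2.
have memV u : u \in V <-> exists2 a, degree_part (4 - j) a = 0 & u = G a.
  split.
    case/memv_sumP => vs vsU ->.
    have H (i : 'I_5) : weight i != weight j -> degree_part (4 - j) (G' (vs i)) = 0 .
      move=> ij; have /mem_U[] := vsU i ij; first exact: weight_le2.
      move=> a; rewrite weight_degree => ha ->; rewrite GK.
      apply: (degree_part_neq _ ha); apply: contra ij => /eqP E; apply/eqP; congr weight.
      by apply: val_inj; have := ltn_ord i; have := ltn_ord j; move: E => /=; lia.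
    exists (\sum_(i | weight i != weight j) G' (vs i)).
      by rewrite linear_sum big1.
    by rewrite linear_sum; apply: eq_bigr => i _ /=; rewrite G'K.
  case=> a a0 ->; rewrite -(sum_degree_part a (leqnn 4)) linear_sum.
  apply: rpred_sum => k _ /=.
  have [->|kj] := eqVneq (k : nat) (4 - j)%N; first by rewrite a0 linear0 mem0v.
  have k5 : (4 - k < 5)%N by rewrite ltnS leq_subr.
  pose i := Ordinal k5.
  have ij : weight i != weight j.
    apply: contra kj => /eqP; rewrite /weight => /addIr [/= <-].
    by rewrite subKn // -ltnS ltn_ord.
  apply: (subvP (sumv_sup i ij (subvv _))).
  have [_] := mem_U (G (degree_part k a)) (weight_le2 i); apply.
  exists (degree_part k a) => //; rewrite weight_degree.
  have -> : (4 - i)%N = k by rewrite /= subKn // -ltnS.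
  exact: homogeneous_degree_part.
have dWV : (W :&: V = 0)%VS.
  apply/eqP; rewrite -subv0; apply/subvP => u; rewrite memv_cap memv0.
  case/andP => /memW[a ha ->] /memV[a' ha' E].
  by rewrite -(degree_part_id ha) -[a]GK E GK ha' linear0.
have vWV : v \in (W + V)%VS.
  pose a := G' v; apply/memv_addP; exists (G (degree_part (4 - j) a)).
    by apply/memW; exists (degree_part (4 - j) a) => //; exact: homogeneous_degree_part.
  exists (G (a - degree_part (4 - j) a)); last by rewrite -linearD /= addrC subrK G'K.
  apply/memV; exists (a - degree_part (4 - j) a) => //.
  by rewrite linearB /= (degree_part_id (@homogeneous_degree_part _ _ _ a)) subrr.
have /memW[a1 h1 E1] := memv_pi W V v.
have /memV[a2 h2 E2] := memv_pi V W v.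
have Ev : v = G (a1 + a2).
  by rewrite linearD /= -E1 -E2 (daddv_pi_add dWV vWV).
have Ea : degree_part (4 - j) (G' v) = a1.
  by rewrite Ev GK hpartD h2 addr0 degree_part_id.
by rewrite Ea -E1.
Qed.

End Weights.

Section ComplexCalculus.
Variables (R : realType) (n : nat).
Local Notation M := 'rV[R]_n.+1.
Local Notation C := R[i].
Implicit Types (f g : M -> C).

Definition csmooth f : Prop :=
  smooth (fun x => complex.Re (f x)) /\ smooth (fun x => complex.Im (f x)).

Lemma ReD (z w : C) : complex.Re (z + w) = complex.Re z + complex.Re w.
Proof. by case: z w => [? ?] [? ?]. Qed.

Lemma ImD (z w : C) : complex.Im (z + w) = complex.Im z + complex.Im w.
Proof. by case: z w => [? ?] [? ?]. Qed.

Lemma ReM (z w : C) : complex.Re (z * w) =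
  complex.Re z * complex.Re w + -1 * (complex.Im z * complex.Im w).
Proof. by case: z w => [? ?] [? ?] /=; rewrite mulN1r. Qed.

Lemma ImM (z w : C) : complex.Im (z * w) =
  complex.Re z * complex.Im w + complex.Im z * complex.Re w.
Proof. by case: z w => [? ?] [? ?]. Qed.

Lemma csmooth_derivations : derivations csmooth (@cpartial R n).
Proof.
have ReDf f g : (fun x => complex.Re (f x + g x)) = fun x => complex.Re (f x) + complex.Re (g x).
  by apply/funext => x; rewrite ReD.
have ImDf f g : (fun x => complex.Im (f x + g x)) = fun x => complex.Im (f x) + complex.Im (g x).
  by apply/funext => x; rewrite ImD.
have ReMf f g : (fun x => complex.Re (f x * g x)) = fun x =>
    complex.Re (f x) * complex.Re (g x) + -1 * (complex.Im (f x) * complex.Im (g x)).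
  by apply/funext => x; rewrite ReM.
have ImMf f g : (fun x => complex.Im (f x * g x)) = fun x =>
    complex.Re (f x) * complex.Im (g x) + complex.Im (f x) * complex.Re (g x).
  by apply/funext => x; rewrite ImM.
have smN (f : M -> R) : smooth f -> smooth (fun x => -1 * f x).
  by move=> sf; exact: (smoothM (smooth_cst _) sf).
split.
- by move=> c; split; exact: smooth_cst.
- move=> f g [f1 f2] [g1 g2]; split; rewrite ?ReDf ?ImDf; exact: smoothD.
- move=> f g [f1 f2] [g1 g2]; split; rewrite ?ReMf ?ImMf.
    exact: (smoothD (smoothM f1 g1) (smN _ (smoothM f2 g2))).
  exact: (smoothD (smoothM f1 g2) (smoothM f2 g1)).
- by move=> i f [f1 f2]; split; exact: smooth_partial.
- by move=> i c; apply/funext => x; rewrite /cpartial !partial_cst.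
- move=> i f g [f1 f2] [g1 g2]; apply/funext => x; rewrite /cpartial ReDf ImDf.
  by rewrite (partialD i f1 g1) (partialD i f2 g2).
- move=> i f g [f1 f2] [g1 g2]; apply/funext => x; rewrite /cpartial ReMf ImMf.
  have c1 : smooth (fun _ : M => -1 : R) by exact: smooth_cst.
  rewrite (partialD i (smoothM f1 g1) (smN _ (smoothM f2 g2))).
  rewrite (partialD i (smoothM f1 g2) (smoothM f2 g1)).
  rewrite (partialM i c1 (smoothM f2 g2)) (partialM i f1 g1) (partialM i f2 g2).
  rewrite (partialM i f1 g2) (partialM i f2 g1).
  rewrite partial_cst; apply/eqP; rewrite eq_complex ReD ImD !ReM !ImM /=.
  by apply/andP; split; apply/eqP; ring.
- move=> i j f [f1 f2]; apply/funext => x; rewrite /cpartial /=.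
  by rewrite (partial_comm i j f1) (partial_comm i j f2).
Qed.

Lemma csmooth_real (f : M -> R) : smooth f -> csmooth (fun x => (f x)%:C%C).
Proof. by move=> sf; split; [exact: sf|exact: smooth_cst]. Qed.

Lemma cpartial_real i (f : M -> R) x : cpartial i (fun y => (f y)%:C%C) x = (partial i f x)%:C%C.
Proof. by rewrite /cpartial /= partial_cst. Qed.

Lemma csmooth_complexify (t : M -> exterior R n.+1) :
  regular_form (@smooth R n) t -> regular_form csmooth (fun x => complexify (t x)).
Proof.
move=> st S; have -> : (fun x => complexify (t x) S) = fun x => (t x S)%:C%C.
  by apply/funext => x; rewrite ffunE.
exact/csmooth_real/st.
Qed.

Lemma extdC_complexify (t : M -> exterior R n.+1) x :
  extdC (fun y => complexify (t y)) x = complexify (extd t x).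
Proof.
rewrite /extdC /ext_deriv -[complexify _]/(map_ext (real_complex R) _) map_ext_sum.
apply: eq_bigr => i _; rewrite map_ext_wedge map_ext_basis; congr wedge.
apply/ffunP => S; rewrite !ffunE -[RHS]cpartial_real; congr (cpartial _ _ x).
by apply/funext => y; rewrite ffunE.
Qed.

End ComplexCalculus.

Lemma weightS (j : 'I_5) (lt5 : (j.+1 < 5)%N) : weight j + 1 = weight (Ordinal lt5).
Proof. by rewrite /weight /=; lia. Qed.

Lemma weight_pred (j : 'I_5) (lt5 : (j.-1 < 5)%N) : (0 < j)%N ->
  weight j - 1 = weight (Ordinal lt5).
Proof. by move=> j0; rewrite /weight /=; lia. Qed.

Lemma degreeS (j : nat) : (j < 4)%N -> (4 - j)%N = (4 - j.+1).+1.
Proof. lia. Qed.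

Lemma degree_pred (j : 'I_5) : (0 < j)%N -> (4 - j.-1)%N = (4 - j).+1.
Proof. by move=> j0; have := ltn_ord j; lia. Qed.

Section Operators.
Variable R : realType.
Local Notation C := R[i].
Local Notation M := 'rV[R]_4.
Variable omega : M -> exterior R 4.
Hypotheses (omega_form : is_form 2 omega) (omega_closed : forall x, extd omega x = 0).
Implicit Types (s t : M -> exterior C 4) (x y : M).

Local Notation HC := (csmooth_derivations R 3).
Local Notation c0 := (- (neg2i R)^-1).
Local Notation G y := (frame (Theta omega y) c0).
Local Notation d := (symbol_deriv (@cpartial R 3) (fun i => wedge (ext_basis C [set i]))).
Local Notation dL := (symbol_deriv (@cpartial R 3) (@bracket C)).
Local Notation csmooth_form := (regular_form (@csmooth R 3)).
Local Notation one := (ext_basis C finset.set0 : exterior C 4).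

Let omega2 y : homogeneous 2 (omega y) := omega_form.1 y.
Let Theta2 y : homogeneous 2 (Theta omega y) := Theta_homogeneous (omega2 y).

Lemma csmooth_Theta : csmooth_form (Theta omega).
Proof.
apply: (regular_form_add HC (csmooth_complexify omega_form.2)).
exact: (regular_form_cst HC).
Qed.

Lemma Theta_closed y : d (Theta omega) y = 0.
Proof.
have n1 := csmooth_complexify omega_form.2.
rewrite (dD HC y n1 (regular_form_cst HC _)).
have -> : d (fun y => complexify (omega y)) y = 0.
  rewrite -[LHS]/(extdC (fun y => complexify (omega y)) y) extdC_complexify omega_closed.
  exact: (map_ext0 (real_complex R)).
rewrite add0r /symbol_deriv big1 // => i _.
by rewrite (form_partial_cst HC) wedge0r.
Qed.

Lemma d_frame s x : csmooth_form s ->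
  d (fun y => G y (s y)) x = G x (d s x - c0 *: dL s x).
Proof.
move=> ns; rewrite /frame.
rewrite (d_exp_form_wedge HC Theta2 csmooth_Theta Theta_closed); last first.
  exact: (regular_form_linear HC (exp_contr_linear _)).
by rewrite (d_exp_contr HC).
Qed.

Lemma sum_degree_part_rev (a : exterior C 4) : \sum_(j < 5) degree_part (4 - j) a = a.
Proof.
rewrite -[RHS](sum_degree_part a (leqnn 4)) [RHS](reindex_inj rev_ord_inj).
by apply: eq_bigr => j _; rewrite /= subSS.
Qed.

Lemma symbol_deriv_degree_part P s x : (forall i, linear (P i)) -> csmooth_form s ->
  \sum_(j < 5) symbol_deriv (@cpartial R 3) P (fun y => degree_part (4 - j) (s y)) x
    = symbol_deriv (@cpartial R 3) P s x.
Proof.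
move=> linP ns; rewrite exchange_big; apply: eq_bigr => i _ /=.
rewrite -[in RHS](sum_degree_part_rev (form_partial _ i s x)).
have P_sum (r : seq 'I_5) (f : 'I_5 -> exterior C 4) :
    \sum_(j <- r) P i (f j) = P i (\sum_(j <- r) f j).
  have P0 : P i 0 = 0.
    have := linP i 1 0 0; rewrite !scale1r addr0 -[LHS]addr0.
    by move=> /addrI <-.
  elim: r => [|j r IH]; first by rewrite !big_nil P0.
  by rewrite !big_cons IH; have := linP i 1 (f j) (\sum_(k <- r) f k); rewrite !scale1r.
rewrite -P_sum; apply: eq_bigr => j _; congr (P i _).
exact: (form_partial_linear HC (@degree_part_is_linear _ _ _)).
Qed.

Lemma pi_frame s (j : 'I_5) :
  pi_ omega (weight j) (fun y => G y (s y)) = fun y => G y (degree_part (4 - j) (s y)).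
Proof.
by apply/funext => y; rewrite (pi_weight (omega2 y)) frameK.
Qed.

(** Of the two terms of d_frame, [L, d] lowers the degree by one, that is, raises
    the weight by one; at the weight 2 it vanishes, as does pi_3. *)
Lemma delbar_frame s x : csmooth_form s ->
  delbar omega (fun y => G y (s y)) x = G x (- c0 *: dL s x).
Proof.
move=> ns; rewrite -(symbol_deriv_degree_part x (@bracket_linear _) ns) scaler_sumr linear_sum.
apply: eq_bigr => j _ /=; rewrite pi_frame.
pose h y := degree_part (4 - j) (s y).
have nh : csmooth_form h by exact: (regular_form_linear HC (@degree_part_is_linear _ _ _) ns).
have hh y : homogeneous (4 - j) (h y) by exact: homogeneous_degree_part.
have dE : extdC (fun y => G y (h y)) x = G x (d h x - c0 *: dL h x) := d_frame x nh.
have [j4|j4] := ltnP j 4; last first.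
  have E : (4 - j)%N = 0%N by apply/eqP; rewrite subn_eq0.
  rewrite pi_out; last by move: j4; case: (j) => [[|[|[|[|[|//]]]]] lt].
  rewrite (dL_homogeneous0 HC) ?scaler0 ?linear0 // => y.
  by have := hh y; rewrite {1}E.
have j5 : (j.+1 < 5)%N by [].
rewrite (weightS j5).
rewrite (pi_weight (omega2 x)).
rewrite dE.
rewrite (frameK _ _ (Theta2 x)).
congr (G x _).
have E := degreeS j4.
have hd : homogeneous (4 - j).+1 (d h x) by exact: (homogeneous_d HC).
have hL : homogeneous (4 - j.+1) (dL h x).
  by apply: (homogeneous_dL HC) => y; have := hh y; rewrite {1}E.
rewrite hpartD (degree_part_neq _ hd) ?add0r; last by rewrite /= neq_ltn E ltnS leqnSn orbT.
by rewrite degree_part_id -?scaleNr //; exact: homogeneousZ.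
Qed.

(** Dually, d raises the degree and lowers the weight; on forms of degree 4 it
    vanishes, as does pi_(-3). *)
Lemma del_frame s x : csmooth_form s ->
  del omega (fun y => G y (s y)) x = G x (d s x).
Proof.
move=> ns; have linw i : linear (wedge (ext_basis C [set i] : exterior C 4)).
  exact: wedge_is_linear.
rewrite -(symbol_deriv_degree_part x linw ns) linear_sum.
apply: eq_bigr => j _ /=; rewrite pi_frame.
pose h y := degree_part (4 - j) (s y).
have nh : csmooth_form h by exact: (regular_form_linear HC (@degree_part_is_linear _ _ _) ns).
have hh y : homogeneous (4 - j) (h y) by exact: homogeneous_degree_part.
have dE : extdC (fun y => G y (h y)) x = G x (d h x - c0 *: dL h x) := d_frame x nh.
have hd : homogeneous (4 - j).+1 (d h x) by exact: (homogeneous_d HC).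
have [j0|j0] := posnP j.
  rewrite pi_out; last by move: j0; case: (j) => [[|[|[|[|[|//]]]]] lt].
  rewrite -/h (homogeneous_gt _ hd) ?linear0 // j0 //.
have j5 : (j.-1 < 5)%N by rewrite (leq_ltn_trans (leq_pred _)).
rewrite (weight_pred j5 j0).
have E := degree_pred j0.
rewrite (pi_weight (omega2 x)).
rewrite dE.
rewrite (frameK _ _ (Theta2 x)).
rewrite [(4 - _)%N]E; congr (G x _).
have hL : degree_part (4 - j).+1 (- (c0 *: dL h x)) = 0.
  case Ej : (4 - j)%N => [|m].
    rewrite (dL_homogeneous0 HC) ?scaler0 ?oppr0 ?linear0 // => y.
    by have := hh y; rewrite {1}Ej.
  rewrite -scaleNr; apply: (@degree_part_neq _ _ m); first by rewrite neq_ltn ltnS leqnSn.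
  apply: homogeneousZ; apply: (homogeneous_dL HC) => y; have := hh y; rewrite {1}Ej; exact.
by rewrite hpartD hL addr0 degree_part_id.
Qed.

End Operators.

(** * Generating functions and pluriharmonic functions *)

Section Generating.
Variable R : realType.
Local Notation M := 'rV[R]_4.
Variables (omega : M -> exterior R 4) (f : M -> R).
Hypotheses (omega_form : is_form 2 omega) (omega_closed : forall x, extd omega x = 0).
Hypothesis f_smooth : smooth f.

Local Notation HD := (smooth_derivations R 3).
Local Notation one := (ext_basis R finset.set0 : exterior R 4).
Local Notation smooth_form := (regular_form (@smooth R 3)).

Definition differential (g : M -> R) := extd (fun y => g y *: one).

Lemma smooth_function (g : M -> R) : smooth g -> smooth_form (fun y => g y *: one).
Proof. by move=> sg; exact: (regular_form_scale HD sg (regular_form_cst HD one)). Qed.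

Lemma is_form_differential (g : M -> R) : smooth g -> is_form 1 (differential g).
Proof.
move=> sg; split; last exact: (regular_d HD (smooth_function sg)).
move=> x; apply: (homogeneous_d HD) => y; exact/homogeneousZ/homogeneous_one.
Qed.

Lemma extd_differential (g : M -> R) x : smooth g -> extd (differential g) x = 0.
Proof. by move=> sg; exact: (d_sqr HD x (smooth_function sg)). Qed.

Lemma is_form_contr_wedge :
  is_form 1 (fun y => contr (wedge (omega y) (differential f y))).
Proof.
have [hdf sdf] := is_form_differential f_smooth; split=> [y|].
  exact/homogeneous_contr/(homogeneous_wedge (omega_form.1 y) (hdf y)).
exact: (regular_form_linear HD (@contr_linear R) (regular_form_wedge HD omega_form.2 sdf)).
Qed.

Lemma extd_combination (g : M -> R) x : smooth g ->
  extd (fun y => f y *: omega y + g y *: Omega R) x =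
  wedge (omega x) (differential f x) + wedge (symp R) (differential g x).
Proof.
move=> sg; have nO := regular_form_cst HD (symp R).
have n1 := regular_form_scale HD f_smooth omega_form.2.
have n2 := regular_form_scale HD sg nO.
have h1 := (is_form_differential f_smooth).1 x.
rewrite [LHS](dD HD x n1 n2) (d_scale HD x f_smooth omega_form.2) (d_scale HD x sg nO).
have -> : symbol_deriv (@partial R 3) (fun i => wedge (ext_basis R [set i])) omega x = 0.
  exact: omega_closed.
have -> : symbol_deriv (@partial R 3) (fun i => wedge (ext_basis R [set i])) (fun=> symp R) x = 0.
  by rewrite /symbol_deriv big1 // => i _; rewrite (form_partial_cst HD) wedge0r.
rewrite !scaler0 !addr0 (wedge_2formC (omega_form.1 x)).
by rewrite (wedge_2formC (homogeneous_symp R)).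
Qed.

(** If f omega + g Omega is exact, then omega /\ df = - Omega /\ dg, and applying L
    shows that L (omega /\ df) = - dg is closed. Conversely, the Poincare lemma
    provides g with L (omega /\ df) = - dg; as L is injective on 3-forms,
    f omega + g Omega is closed, and the Poincare lemma applies again. *)
Lemma generating_functionP : generating_function omega f <->
  forall x, extd (fun y => contr (wedge (omega y) (differential f y))) x = 0.
Proof.
split=> [[alpha [g [[_ sa] sg ag]]] x|closed].
  have ga y : wedge (omega y) (differential f y) = - wedge (symp R) (differential g y).
    apply/eqP; rewrite -addr_eq0 -extd_combination //.
    have -> : (fun y => f y *: omega y + g y *: Omega R) = extd alpha.
      by apply/funext => z; rewrite ag.
    exact/eqP/(d_sqr HD y sa).
  have -> : (fun y => contr (wedge (omega y) (differential f y))) =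
      fun y => - differential g y.
    apply/funext => y; rewrite ga linearN /= contr_symp1 //.
    exact: (is_form_differential sg).1.
  rewrite [LHS](dN HD x (is_form_differential sg).2); apply/eqP; rewrite oppr_eq0.
  exact/eqP/extd_differential.
have [hdf sdf] := is_form_differential f_smooth.
pose beta y := contr (wedge (omega y) (differential f y)).
have h3 y := homogeneous_wedge (omega_form.1 y) (hdf y).
have [s [hs ss] ds] := poincare is_form_contr_wedge closed.
(* s is a 0-form, that is, a function times the unit *)
pose g y := -1 * s y finset.set0.
have sg : smooth g by exact: (smoothM (smooth_cst _) (ss _)).
have dg y : differential g y = - beta y.
  rewrite -[beta y](ds y) -[RHS](dN HD y ss) /differential; congr (symbol_deriv _ _ _ y).
  by apply/funext => z; rewrite [in RHS](homogeneous0_one (hs z)) /g mulN1r scaleNr.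
have [hdg sdg] := is_form_differential sg.
have zero y : wedge (omega y) (differential f y) + wedge (symp R) (differential g y) = 0.
  apply: contr_inj3.
    exact: (homogeneousD (h3 y) (homogeneous_wedge (@homogeneous_symp R) (hdg y))).
  by rewrite contrD [X in _ + X](contr_symp1 (hdg y)) (dg y) addrN.
pose eta y := f y *: omega y + g y *: Omega R.
have eta2 : is_form 2 eta.
  split=> [y|]; last first.
    exact: (regular_form_add HD (regular_form_scale HD f_smooth omega_form.2)
      (regular_form_scale HD sg (regular_form_cst HD (Omega R)))).
  apply: homogeneousD; first exact/homogeneousZ/omega_form.1.
  exact/homogeneousZ/homogeneous_symp.
have [|alpha a1 da] := poincare eta2.
  by move=> y; rewrite extd_combination.
by exists alpha, g.
Qed.

End Generating.

Section Pluriharmonic.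
Variable R : realType.
Local Notation C := R[i].
Local Notation M := 'rV[R]_4.
Variables (omega : M -> exterior R 4) (f : M -> R).
Hypotheses (omega_form : is_form 2 omega) (omega_closed : forall x, extd omega x = 0).
Hypothesis f_smooth : smooth f.

Local Notation HC := (csmooth_derivations R 3).
Local Notation c0 := (- (neg2i R)^-1).
Local Notation G y := (frame (Theta omega y) c0).
Local Notation d := (symbol_deriv (@cpartial R 3) (fun i => wedge (ext_basis C [set i]))).
Local Notation dL := (symbol_deriv (@cpartial R 3) (@bracket C)).
Local Notation csmooth_form := (regular_form (@csmooth R 3)).
Local Notation one := (ext_basis C finset.set0 : exterior C 4).
Local Notation fC := (fun y => (f y)%:C%C *: one).

Lemma complexify_contr (a : exterior R 4) : complexify (contr a) = contr (complexify a).
Proof.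
rewrite -![complexify _]/(map_ext (real_complex R) _) !contrE map_extD !map_ext_interior.
have E (i : 'I_4) : map_mx (real_complex R) (delta_mx 0 i : 'rV_4) = delta_mx 0 i.
  by apply/rowP => j; rewrite !mxE rmorph_nat.
by rewrite !E.
Qed.

Lemma function_formE : function_form f = fC.
Proof.
apply/funext => y; rewrite /function_form -[complexify _]/(map_ext (real_complex R) _).
by rewrite map_extZ map_ext_basis.
Qed.

(** The imaginary part of Theta contributes d L (Omega /\ df) = d df = 0. *)
Lemma d_contr_Theta x :
  d (fun y => contr (wedge (Theta omega y) (d fC y))) x =
  complexify (extd (fun y => contr (wedge (omega y) (differential f y))) x).
Proof.
have dfE y : d fC y = complexify (differential f y).
  by rewrite -extdC_complexify -function_formE.
have [hdf sdf] := is_form_differential f_smooth.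
have sdfC : csmooth_form (fun y => complexify (differential f y)) by exact: csmooth_complexify.
pose beta y := contr (wedge (omega y) (differential f y)).
have sbeta : regular_form (@smooth R 3) beta := (is_form_contr_wedge omega_form f_smooth).2.
have E : (fun y => contr (wedge (Theta omega y) (d fC y))) =
    fun y => complexify (beta y) + - 'i%C *: complexify (differential f y).
  apply/funext => y; rewrite dfE /Theta wedgeDl wedgeNl wedgeZl contrD complexify_Omega.
  rewrite -scaleNr contrZ contr_symp1; last first.
    exact: (homogeneous_map_ext (real_complex R) (hdf y)).
  congr (_ + _); rewrite complexify_contr; congr contr.
  exact/esym/(map_ext_wedge (real_complex R)).
have n1 : csmooth_form (fun y => complexify (beta y)) by exact: csmooth_complexify.
have nc : csmooth (fun _ : M => - 'i%C : C) by exact: (regular_cst HC).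
rewrite E (dD HC x n1 (regular_form_scale HC nc sdfC)) (d_cst_scale HC _ x sdfC).
rewrite -[X in X + _]/(extdC (fun y => complexify (beta y)) x) extdC_complexify.
rewrite -[X in _ *: X]/(extdC (fun y => complexify (differential f y)) x) extdC_complexify.
have -> : extd (differential f) x = 0 by exact: extd_differential.
have -> : complexify (0 : exterior R 4) = 0 by exact: (map_ext0 (real_complex R)).
by rewrite scaler0 addr0.
Qed.

Lemma del_delbarE x : del omega (delbar omega (function_form f)) x =
  G x (c0 *: exp_contr (- c0) (complexify
    (extd (fun y => contr (wedge (omega y) (differential f y))) x))).
Proof.
have Theta2 y : homogeneous 2 (Theta omega y) by exact/Theta_homogeneous/omega_form.1.
have sT : csmooth_form (Theta omega) by exact: csmooth_Theta.
have cT y : d (Theta omega) y = 0 by exact: Theta_closed.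
have sf : csmooth (fun y => (f y)%:C%C : C) by exact: csmooth_real.
have sfC : csmooth_form fC by exact: (regular_form_scale HC sf (regular_form_cst HC one)).
pose s y := unframe (Theta omega y) c0 (fC y).
have ss : csmooth_form s.
  have sN : csmooth_form (fun y => - Theta omega y) := regular_opp HC sT.
  exact: (regular_form_linear HC (exp_contr_linear _)
    (regular_form_wedge HC (regular_exp_form HC sN) sfC)).
have fE : function_form f = fun y => G y (s y).
  by rewrite function_formE; apply/funext => y; rewrite unframeK.
have sL : csmooth_form (dL s) := regular_dL HC ss.
have scL : csmooth_form (fun y => - c0 *: dL s y) := regular_form_scale HC (regular_cst HC _) sL.
have -> : delbar omega (function_form f) = fun y => G y (- c0 *: dL s y).
  by apply/funext => y; rewrite fE (delbar_frame omega_form omega_closed y ss).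
rewrite (del_frame omega_form omega_closed x scL) (d_cst_scale HC _ x sL); congr (G x _).
rewrite (d_dL_function HC c0 Theta2 sT cT sf x) d_contr_Theta.
by rewrite scalerN scaleNr opprK.
Qed.

End Pluriharmonic.

Theorem proposition5 (R : realType) (omega : 'rV[R]_4 -> exterior R 4)
    (omega_form : is_form 2 omega) (omega_closed : forall x, extd omega x = 0)
    (f : 'rV[R]_4 -> R) (f_smooth : smooth f) :
  generating_function omega f <-> pluriharmonic omega f.
Proof.
rewrite generating_functionP //; split=> H x.
  have c0 : complexify (0 : exterior R 4) = 0 by exact: (map_ext0 (real_complex R)).
  by rewrite del_delbarE // H c0 linear0 scaler0 linear0.
have := H x; rewrite del_delbarE //.
set z := extd _ x => E.
have Theta2 : homogeneous 2 (Theta omega x) by exact/Theta_homogeneous/omega_form.1.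
have c_neq0 : - (neg2i R)^-1 != 0 by rewrite oppr_eq0 invr_eq0 neg2i_neq0.
have := frameK (- (neg2i R)^-1)
  (- (neg2i R)^-1 *: exp_contr (- - (neg2i R)^-1) (complexify z)) Theta2.
rewrite E /unframe wedge0r linear0 => /esym/eqP.
rewrite scaler_eq0 (negPf c_neq0) /= => /eqP E1.
have := exp_contrK (- (neg2i R)^-1) (complexify z); rewrite E1 linear0 => /esym/ffunP Ez.
apply/ffunP => S; have := Ez S; rewrite !ffunE => /eqP.
by rewrite eq_complex /= eqxx andbT => /eqP.
Qed.
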